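(* Let $f(z)=e^z$ on $\mathbb{C}$ and let $\mathbf{c}=c_0c_1c_2\ldots$ be a sequence of integers. The set $\Lambda_{\mathbf{c}}$ of all points with itinerary $\mathbf{c}$ is non-empty if and only if $\mathbf{c}$ is exponentially bounded, and whenever $\Lambda_{\mathbf{c}}$ is non-empty, $$\dim_H(\Lambda_{\mathbf{c}})=1.$$
   Context: $\mathbb{N}=\{0,1,2,\ldots\}$. For $k\in\mathbb{Z}$ let $P_k=\{z\in\mathbb{C}:(2k-1)\pi<\operatorname{Im}(z)\leqslant(2k+1)\pi\}$. For a sequence of integers $\mathbf{c}=c_0c_1c_2\ldots$ (an itinerary), $\Lambda_{\mathbf{c}}=\{z\in\mathbb{C}: f^n(z)\in P_{c_n}\text{ for all }n\in\mathbb{N}\}$, where $f^n$ is the $n$-th iterate of $f$. The sequence $\mathbf{c}$ is exponentially bounded if there exist $A,x>0$ such that $|c_k|<A\,F^k(x)$ for all $k\in\mathbb{N}$, where $F\colon\mathbb{R}\to\mathbb{R}$, $F(t)=e^t-1$, and $F^k$ is its $k$-th iterate. $\dim_H$ denotes Hausdorff dimension. *)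

(* Defs.v *)
From HB Require Import structures.
From mathcomp Require Import all_boot all_order all_algebra.
From mathcomp Require Import all_classical all_reals all_analysis.
From mathcomp Require Import complex.

Set Implicit Arguments.
Unset Strict Implicit.
Unset Printing Implicit Defensive.

Import Order.TTheory GRing.Theory Num.Theory.
Import numFieldNormedType.Exports.

Local Open Scope classical_set_scope.
Local Open Scope ring_scope.
Local Open Scope complex_scope.

Section HausdorffDimension.
Context {R : realType} {T : Type}.
Variable d : T -> T -> R.

(* The extra [0] only matters for [U = set0], where the supremum would
   otherwise be [-oo]. *)
Definition diam (U : set T) : \bar R :=
  ereal_sup (0%E |` [set (d p.1 p.2)%:E | p in U `*` U]).

Definition delta_cover (delta : R) (A : set T) : set (nat -> set T) :=
  [set U | A `<=` \bigcup_k U k /\ forall k, (diam (U k) <= delta%:E)%E].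

(* Empty members of a cover are skipped, so that finite covers are covers by a
   sequence padded with [set0] even when [s = 0] ([0 `^ 0 = 1], as it should be
   for a singleton). *)
Definition hausdorff_premeasure (s delta : R) (A : set T) : \bar R :=
  ereal_inf [set (\sum_(0 <= k <oo | U k != set0) diam (U k) `^ s)%E
            | U in delta_cover delta A].

Definition hausdorff_measure (s : R) (A : set T) : \bar R :=
  ereal_sup [set hausdorff_premeasure s delta A | delta in [set x : R | 0 < x]].

Definition hausdorff_dim (A : set T) : \bar R :=
  ereal_inf [set s%:E | s in [set s : R | 0 <= s /\
                                          hausdorff_measure s A = 0%E]].

End HausdorffDimension.

Section ExponentialDynamics.
Context {R : realType}.

(* The norm [`|z|] of [R[i]] is [R[i]]-valued; [normc] is the real-valued
   modulus. *)
Definition cdist (z w : R[i]) : R := ComplexField.Normc.normc (z - w).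

Definition cexp (z : R[i]) : R[i] :=
  (expR (complex.Re z))%:C * (cos (complex.Im z) +i* sin (complex.Im z)).

Definition strip (k : int) : set R[i] :=
  [set z | (2 * k%:~R - 1) * pi < complex.Im z <= (2 * k%:~R + 1) * pi].

Definition itinerary_set (c : nat -> int) : set R[i] :=
  [set z | forall n, strip (c n) (iter n cexp z)].

Definition exponentially_bounded (c : nat -> int) : Prop :=
  exists A x : R, [/\ 0 < A, 0 < x &
    forall k : nat, `|c k|%:~R < A * iter k (fun t => expR t - 1) x].

End ExponentialDynamics.

Arguments strip : clear implicits.
Arguments itinerary_set : clear implicits.
Arguments exponentially_bounded : clear implicits.

(* Main.v *)
Require Import Defs.
From HB Require Import structures.
From mathcomp Require Import all_boot all_order all_algebra.
From mathcomp Require Import all_classical all_reals all_analysis.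
From mathcomp Require Import complex.
From mathcomp Require Import ring lra.

(** Write f for the exponential, L for the set of points with itinerary c.

    Growth of c. The real part of f^k(z) and the modulus of its imaginary part
    are dominated by the iterates of exp t - 1 at a slightly larger starting
    value, and c_k is comparable to that imaginary part; so a point of L
    forces c to be exponentially bounded
    ([exponentially_bounded_of_nonempty]). Conversely, on a vertical line far
    to the right one finds nested segments whose n-th image crosses the n-th
    strip from bottom to top at a huge real part: the exponential bends such a
    crossing into an arc of a huge circle, which crosses the next strip
    ([crosses_step]). The common point of the segments lies in L
    ([hair_point]). Hence the real part maps L onto a half-line; as it is
    1-Lipschitz, L has positive one-dimensional measure and dimension at least
    1 ([hausdorff_dim_ge1]).

    Dimension at most 1. Fix s > 1. Two points with the same itinerary are
    compared after m steps, and pulled back along their common inverse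
    branches. These branches are logarithms from a half-plane into a
    half-strip, so by Schwarz-Pick they do not increase the hyperbolic
    distance of the half-plane ([hyp2_le]), and they shrink bounded distances
    by a definite factor at each time k for which f^k(z) is at distance at
    least pi/4 from the real axis ([hyp2_gain]). Cut the strip reached at time
    m + 1 into tiles of bounded size: boundedly many of them have real part of
    modulus between n and n + 1, and their pullbacks to time m already have
    size at most of order 1/(n + 1). The sum of the (n + 1)^-s converges, and
    this is where the value 1 of the dimension comes from.

    The time m depends on the point: it is the first time from N on at which
    the orbit is at distance at least pi/4 from the real axis and not far to
    the left, called a good time. If the orbit stays q steps near the axis
    before that time, it moves to the right, and the size of the pullback
    gains a factor exponentially small in q ([weight_ge_gap]). So the sum over
    all m converges too, and the set of points of L having nu good times
    before N and then at least q0 narrow steps has content at most a multiple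
    of h^nu t^q0, with h and t less than 1 ([hausdorff_content_narrow_from]).
    Three kinds of points remain to be collected. If there is a good time in
    [N, 2N) for every large N, then nu can be taken arbitrarily large; if for
    infinitely many N there is none, the terms t^N are summable; an orbit that
    stays near the axis forever becomes real ([real_of_narrow]), and such
    points lie in countably many preimages of a line. *)

Set Implicit Arguments.
Unset Strict Implicit.
Unset Printing Implicit Defensive.

Import Order.TTheory GRing.Theory Num.Theory.
Import numFieldNormedType.Exports.

Local Open Scope classical_set_scope.
Local Open Scope ring_scope.

(** * Elementary inequalities for sine, cosine and the exponential *)

Section RealInequalities.
Context {R : realType}.
Implicit Types x y u v h : R.

Lemma is_derive_ge0_le (f df : R -> R) (b : R) : 0 <= b ->
  (forall x, is_derive x 1 f (df x)) ->
  (forall x, 0 <= x <= b -> 0 <= df x) -> f 0 <= f b.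
Proof.
move=> b0 fdf df0.
have cf : {within `[0, b], continuous f}.
  by apply: derivable_within_continuous => x _; have [] := fdf x.
have [c cb fE] := MVT_segment b0 (fun x _ => fdf x) cf.
rewrite -subr_ge0 fE subr0 mulr_ge0 //; apply: df0.
by rewrite in_itv /= in cb.
Qed.

Lemma sin_le x : 0 <= x -> sin x <= x.
Proof.
move=> x0.
have := @is_derive_ge0_le (fun x => x - sin x) (fun x => 1 - cos x) x x0.
rewrite sin0 !subr0 subr_ge0; apply => t.
by rewrite subr_ge0 cos_le1.
Qed.

Lemma mul_cos_le_sin x : 0 <= x <= pi -> x * cos x <= sin x.
Proof.
move=> /andP[x0 xpi].
have := @is_derive_ge0_le (fun x => sin x - x * cos x) (fun x => x * sin x) x x0.
rewrite sin0 mul0r !subr0 subr_ge0; apply => t.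
  by apply: is_derive_eq; rewrite /GRing.scale /=; ring.
by move=> /andP[t0 tx]; rewrite mulr_ge0// sin_ge0_pi// t0 (le_trans tx).
Qed.

Lemma expR_sinh_ge u : 0 <= u -> 2 * u <= expR u - expR (- u).
Proof.
move=> u0.
have := @is_derive_ge0_le (fun x => expR x - expR (- x) - 2 * x)
  (fun x => expR x + expR (- x) - 2) u u0.
rewrite oppr0 expR0 mulr0 !subrr => h; rewrite -subr_ge0; apply: h => t.
  by apply: is_derive_eq; rewrite /GRing.scale /=; ring.
move=> _; rewrite expRN.
have e0 := expR_gt0 t.
rewrite (_ : _ - 2 = (expR t - 1) ^+ 2 / expR t); last by field; rewrite gt_eqF.
by rewrite divr_ge0 ?sqr_ge0 ?ltW.
Qed.

Lemma sqr_le_cosh u : u ^+ 2 <= expR u + expR (- u) - 2.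
Proof.
wlog u0 : u / 0 <= u => [H|].
  have [/H //|/ltW u0] := leP 0 u.
  by have := H (- u); rewrite oppr_ge0 sqrrN opprK [X in X - 2]addrC => /(_ u0).
have := @is_derive_ge0_le (fun x => expR x + expR (- x) - 2 - x ^+ 2)
  (fun x => expR x - expR (- x) - 2 * x) u u0.
rewrite oppr0 expR0 expr0n /= => h; rewrite -subr_ge0.
apply: le_trans (h _ _); first by lra.
  by move=> t; apply: is_derive_eq; rewrite /GRing.scale /=; ring.
by move=> t /andP[t0 _]; rewrite subr_ge0 expR_sinh_ge.
Qed.

(** The addition formula and [u cos u <= sin u] reduce a comparison of [sin (u
    + h) / (u + h)] with [sin u / u] to one at the increment [h] alone; with
    [g < 1] it says that the sinc function drops by a definite factor over an
    increment bounded below. *)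
Lemma sinc_contraction g u h : 0 <= u -> 0 <= h -> u + h <= pi ->
  sin h <= g * h -> cos h <= g -> u * sin (u + h) <= g * (u + h) * sin u.
Proof.
move=> u0 h0 uh sh ch; rewrite sinD mulrDr.
have su : 0 <= sin u by apply: sin_ge0_pi; rewrite u0 (le_trans _ uh) // lerDl.
have sh0 : 0 <= sin h by apply: sin_ge0_pi; rewrite h0 (le_trans _ uh) // lerDr.
have ucu : u * cos u <= sin u by apply: mul_cos_le_sin; rewrite u0 (le_trans _ uh) // lerDl.
rewrite (_ : g * _ * _ = u * (sin u * g) + sin u * (g * h)); last by ring.
rewrite lerD //; first by rewrite ler_wpM2l// ler_wpM2l.
by rewrite mulrA (le_trans (ler_wpM2r sh0 ucu))// ler_wpM2l.
Qed.

Lemma sinc_decreasing u v : 0 <= u -> u <= v -> v <= pi ->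
  u * sin v <= v * sin u.
Proof.
move=> u0 uv vpi.
have vu : 0 <= v - u by rewrite subr_ge0.
have := @sinc_contraction 1 u (v - u) u0 vu.
rewrite addrC subrK !mul1r; apply => //.
exact: sin_le.
Qed.

(** This turns the product of sines in the hyperbolic distance into a
    difference of squares, matching [x y = ((x+y)/2)^2 - ((x-y)/2)^2]. *)
Lemma sin_sqr_diff x y : sin x * sin y = sin ((x + y) / 2) ^+ 2 - sin ((x - y) / 2) ^+ 2.
Proof.
have -> : (x + y) / 2 = x / 2 + y / 2 by lra.
have -> : (x - y) / 2 = x / 2 - y / 2 by lra.
rewrite {1}(_ : x = (x / 2) *+ 2); last by lra.
rewrite {1}(_ : y = (y / 2) *+ 2); last by lra.
rewrite !sin_mulr2n sinD sinB.
by ring.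
Qed.

Lemma one_sub_cos x : 1 - cos x = 2 * sin (x / 2) ^+ 2.
Proof.
by rewrite {1}(_ : x = (x / 2) *+ 2); [rewrite cos_mulr2n cos2sin2; ring|lra].
Qed.

Lemma one_sub_cos_ge x : `|x| <= pi -> 2 * x ^+ 2 <= (1 - cos x) * pi ^+ 2.
Proof.
move=> xpi; rewrite -[cos x]cos_norm -(real_normK (num_real x)); move: xpi (normr_ge0 x).
move: (`|x|) => {}x xpi x0.
have p0 := @pi_gt0 R.
rewrite one_sub_cos.
have : x / 2 * sin (pi / 2) <= pi / 2 * sin (x / 2) by apply: sinc_decreasing; lra.
rewrite sin_pihalf mulr1 => H.
rewrite (_ : 2 * x ^+ 2 = 8 * (x / 2) ^+ 2); last by field.
rewrite (_ : _ * pi ^+ 2 = 8 * (pi / 2 * sin (x / 2)) ^+ 2); last by field.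
by rewrite ler_pM2l// ler_sqr// nnegrE; [|apply: le_trans H]; lra.
Qed.

End RealInequalities.

(** * Hausdorff content and null sets *)

Section HausdorffContent.
Context {R : realType} {T : Type}.
Variables (d : T -> T -> R) (s : R).

(** The premeasure with no bound on the diameters. It has the same null sets
    as the measure, and needs no mesh parameter. *)
Definition hausdorff_content (A : set T) : \bar R :=
  ereal_inf [set (\sum_(k <oo) diam d (U k) `^ s)%E
            | U in [set U : nat -> set T | A `<=` \bigcup_k U k]].

Lemma diam_ge0 U : (0 <= diam d U)%E.
Proof. by apply: ereal_sup_ubound; left. Qed.

Lemma diam_le U (r : R) : 0 <= r ->
  (forall x y, U x -> U y -> d x y <= r) -> (diam d U <= r%:E)%E.
Proof.
move=> r0 dr; apply: ge_ereal_sup => _ [->|[[x y] [/= Ux Uy] <-]].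
  by rewrite lee_fin.
by rewrite lee_fin dr.
Qed.

Lemma le_diam U x y : U x -> U y -> ((d x y)%:E <= diam d U)%E.
Proof. by move=> Ux Uy; apply: ereal_sup_ubound; right; exists (x, y). Qed.

Lemma diam0 : diam d set0 = 0%E.
Proof.
apply/eqP; rewrite eq_le diam_ge0 andbT.
by apply: diam_le => // x y [].
Qed.

Lemma hausdorff_content_ge0 A : (0 <= hausdorff_content A)%E.
Proof.
by apply: le_ereal_inf_tmp => _ [U _ <-]; apply: nneseries_ge0 => n _ _; exact: poweR_ge0.
Qed.

Lemma hausdorff_content_mono A B : A `<=` B -> (hausdorff_content A <= hausdorff_content B)%E.
Proof.
move=> AB; apply: ereal_inf_le_tmp => _ [U BU <-]; exists U => //.
exact: subset_trans BU.
Qed.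

Hypothesis s_gt0 : 0 < s.

Lemma poweR_le2 (x y : \bar R) : (0 <= x -> x <= y -> x `^ s <= y `^ s)%E.
Proof.
move=> x0 xy; apply: gt0_ler_poweR => //; first exact: ltW.
  by rewrite in_itv /= x0 leey.
by rewrite in_itv /= (le_trans x0 xy) leey.
Qed.

Lemma poweR_diam_le U (r : R) : 0 <= r ->
  (forall x y, U x -> U y -> d x y <= r) -> (diam d U `^ s <= (r `^ s)%:E)%E.
Proof.
move=> r0 dr; rewrite -poweR_EFin.
by apply: poweR_le2; [exact: diam_ge0 | exact: diam_le].
Qed.

Lemma hausdorff_content_diam_le A (r : R) : 0 <= r ->
  (forall x y, A x -> A y -> d x y <= r) -> (hausdorff_content A <= (r `^ s)%:E)%E.
Proof.
move=> r0 dr.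
apply: (@le_trans _ _ (diam d A `^ s)%E); last exact: poweR_diam_le.
apply: ge_ereal_inf; exists (diam d A `^ s)%E => //.
exists (fun k => if k == 0%N then A else set0) => [x Ax|]; first by exists 0%N.
rewrite nneseries_recl//; last by move=> k _; exact: poweR_ge0.
rewrite /= eseries0 ?adde0// => k k0 _.
by rewrite gtn_eqF// diam0 poweR0r ?gt_eqF.
Qed.

(** Countable subadditivity, with real bounds: almost optimal covers of the [A
    n], with errors [eps / 2^(n+1)], are merged along a bijection of the
    naturals with the pairs of naturals. *)
Lemma hausdorff_content_bigcup_le (A : nat -> set T) (e : nat -> R) (E : R) :
  (forall n, (hausdorff_content (A n) <= (e n)%:E)%E) ->
  (forall n, \sum_(0 <= i < n) e i <= E) ->
  (hausdorff_content (\bigcup_n A n) <= E%:E)%E.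
Proof.
move=> Ae eE; apply/lee_addgt0Pr => eps eps0.
have e2 n : 0 < eps / 2 ^+ n.+1 by rewrite divr_gt0// exprn_gt0.
have /choice[G HG] n : exists U : nat -> set T, A n `<=` \bigcup_k U k /\
    (\sum_(k <oo) diam d (U k) `^ s <= (e n + eps / 2 ^+ n.+1)%:E)%E.
  have : (hausdorff_content (A n) < (e n + eps / 2 ^+ n.+1)%:E)%E.
    by apply: le_lt_trans (Ae n) _; rewrite lte_fin ltrDl.
  by move=> /ereal_inf_lt[_ [U AU <-] /ltW]; exists U.
have /card_esym/ppcard_eqP[f] := card_nat2.
pose a (ij : nat * nat) : \bar R := (diam d (G ij.1 ij.2) `^ s)%E.
have a0 ij : (0 <= a ij)%E by exact: poweR_ge0.
apply: (@le_trans _ _ (\sum_(k <oo) a (f k))%E).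
  apply: ereal_inf_lbound; exists (fun k => G (f k).1 (f k).2) => // x [i _].
  move=> /((HG i).1 x)[j _ Gx]; exists (f^-1%FUN (i, j)) => //=.
  by rewrite invK ?inE.
rewrite nneseries_esumT//.
rewrite -(@reindex_esum R nat (nat * nat)%type setT setT f a); last first.
  exact: bij.
rewrite (_ : [set: nat * nat] = [set: nat] `*`` (fun=> [set: nat])); last first.
  by apply/seteqP; split.
rewrite -(@esum_esum _ _ _ setT (fun=> setT) (fun i j => a (i, j)))//.
rewrite -nneseries_esumT; last by move=> n; apply: esum_ge0.
under eq_eseriesr do rewrite -nneseries_esumT//.
apply: lime_le.
  by apply: is_cvg_nneseries => n _ _; apply: nneseries_ge0.
apply: nearW => n.
apply: (@le_trans _ _ (\sum_(0 <= i < n) (e i + eps / 2 ^+ i.+1)%:E)%E).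
  by apply: lee_sum => i _; exact: (HG i).2.
rewrite -EFinD sumEFin lee_fin big_split /= lerD//.
rewrite (_ : \sum_(0 <= i < n) _ = eps * (1 - (2 ^+ n)^-1)); last first.
  elim: n => [|n IH]; first by rewrite big_geq// expr0 invr1 subrr mulr0.
  rewrite big_nat_recr//= IH exprS; field.
  by rewrite expf_neq0// pnatr_eq0.
by rewrite ger_pMr// gerBl invr_ge0 exprn_ge0.
Qed.

Lemma hausdorff_content_bigcup0 (A : nat -> set T) :
  (forall n, hausdorff_content (A n) = 0%E) -> hausdorff_content (\bigcup_n A n) = 0%E.
Proof.
move=> A0; apply/eqP; rewrite eq_le hausdorff_content_ge0 andbT.
apply: (@hausdorff_content_bigcup_le A (fun=> 0)); first by move=> n; rewrite A0.
by move=> n; rewrite big1.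
Qed.

Lemma hausdorff_content0 : hausdorff_content set0 = 0%E.
Proof.
apply/eqP; rewrite eq_le hausdorff_content_ge0 andbT.
have := @hausdorff_content_diam_le set0 0 (lexx _).
by rewrite powR0 ?gt_eqF//; apply => x y [].
Qed.

Lemma hausdorff_content_setU_le A B (x y : R) : (hausdorff_content A <= x%:E)%E ->
  (hausdorff_content B <= y%:E)%E -> (hausdorff_content (A `|` B) <= (x + y)%:E)%E.
Proof.
move=> Ax By; rewrite -bigcup2E.
have x0 : 0 <= x by rewrite -lee_fin (le_trans (hausdorff_content_ge0 A)).
have y0 : 0 <= y by rewrite -lee_fin (le_trans (hausdorff_content_ge0 B)).
apply: (@hausdorff_content_bigcup_le _ (fun n => if n == 0%N then x else if n == 1%N then y else 0)).
  by case=> [|[|n]] //=; rewrite hausdorff_content0.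
case=> [|n]; first by rewrite big_geq// addr_ge0.
rewrite big_nat_recl//=; case: n => [|n]; first by rewrite big_geq// lerD2l.
by rewrite big_nat_recl//= big1 ?addr0.
Qed.

Lemma hausdorff_content_setU0 A B : hausdorff_content A = 0%E -> hausdorff_content B = 0%E ->
  hausdorff_content (A `|` B) = 0%E.
Proof.
move=> A0 B0; apply/eqP; rewrite eq_le hausdorff_content_ge0 andbT -[0%E]/(0%:E) -[0%R]addr0.
by apply: hausdorff_content_setU_le; rewrite ?A0 ?B0.
Qed.

Lemma hausdorff_content_eq0 A :
  (forall e : R, 0 < e -> (hausdorff_content A <= e%:E)%E) -> hausdorff_content A = 0%E.
Proof.
move=> Ae; apply/eqP; rewrite eq_le hausdorff_content_ge0 andbT.
by apply/lee_addgt0Pr => e e0; rewrite add0e Ae.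
Qed.

Lemma hausdorff_content_sub0 A B : A `<=` B -> hausdorff_content B = 0%E -> hausdorff_content A = 0%E.
Proof.
move=> AB B0; apply/eqP; rewrite eq_le hausdorff_content_ge0 andbT -B0.
exact: hausdorff_content_mono.
Qed.

(** A cover whose sum of [s]-th powers is at most [delta^s] has all its
    diameters at most [delta], so the bound on the mesh costs nothing. *)
Lemma hausdorff_measure_eq0 A : hausdorff_content A = 0%E -> hausdorff_measure d s A = 0%E.
Proof.
move=> A0.
have pre0 delta : 0 < delta -> hausdorff_premeasure d s delta A = 0%E.
  move=> delta0; apply/eqP; rewrite eq_le; apply/andP; split; last first.
    apply: le_ereal_inf_tmp => _ [U _ <-].
    by apply: nneseries_ge0 => n _ _; exact: poweR_ge0.
  apply/lee_addgt0Pr => e e0; rewrite add0e.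
  have m0 : 0 < Num.min e (delta `^ s) by rewrite lt_min e0 powR_gt0.
  have /ereal_inf_lt[_ [U AU <-] /ltW Um] :
    (hausdorff_content A < (Num.min e (delta `^ s))%:E)%E by rewrite A0 lte_fin.
  have dU k : (diam d (U k) <= delta%:E)%E.
    have : (diam d (U k) `^ s <= (delta%:E `^ s))%E.
      apply: (@le_trans _ _ (\sum_(k <oo) diam d (U k) `^ s)%E); last first.
        by apply: le_trans Um _; rewrite lee_fin ge_min lexx orbT.
      apply: le_trans (nneseries_lim_ge k.+1 _).
        by rewrite big_nat_recr//= leeDr// sume_ge0// => i _; exact: poweR_ge0.
      by move=> n _ _; exact: poweR_ge0.
    apply: contraTT; rewrite -!ltNge => lt.
    rewrite lt_neqAle poweR_le2 ?(ltW lt) ?lee_fin ?(ltW delta0)// andbT; apply/eqP => /(congr1 (fun x => (x `^ s^-1)%E)).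
    rewrite -!poweRrM divff ?gt_eqF// !poweRe1 ?diam_ge0 ?lee_fin ?ltW// => E.
    by rewrite E ltxx in lt.
  apply: ge_ereal_inf; exists (\sum_(0 <= k <oo | U k != set0) diam d (U k) `^ s)%E.
    by exists U.
  apply: (@le_trans _ _ (\sum_(k <oo) diam d (U k) `^ s)%E).
    rewrite eseries_mkcond; apply: lee_nneseries => n *; case: ifP => // _;
      exact: poweR_ge0.
  by apply: le_trans Um _; rewrite lee_fin ge_min lexx.
apply/eqP; rewrite eq_le; apply/andP; split.
  by apply: ge_ereal_sup => _ [delta /= delta0 <-]; rewrite pre0.
by apply: ereal_sup_ubound; exists 1 => //=; rewrite pre0.
Qed.

End HausdorffContent.


(** * Bounds for the Hausdorff dimension *)

Section DimensionBounds.
Context {R : realType} {T : Type}.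
Variables (d : T -> T -> R) (A : set T).

Lemma hausdorff_dim_le1 :
  (forall s : R, 1 < s -> hausdorff_content d s A = 0%E) -> (hausdorff_dim d A <= 1%:E)%E.
Proof.
move=> A0; apply/lee_addgt0Pr => e e0; rewrite -EFinD.
have e1 : 1 < 1 + e by rewrite ltrDl.
apply: ereal_inf_lbound; exists (1 + e) => //; split.
  by rewrite addr_ge0// ltW.
by apply: hausdorff_measure_eq0; [exact: lt_trans e1 | exact: A0].
Qed.

Variables (p : T -> R) (a : R).
Hypothesis p_lip : forall x y, `|p x - p y| <= d x y.
Hypothesis p_onto : forall t, a <= t <= a + 1 -> exists2 x, A x & p x = t.

(** The images under [p] of the members of the cover lie in intervals at most
    twice as long as their diameters, and these intervals cover [[a, a + 1]]:
    Lebesgue measure is subadditive. *)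
Lemma sum_diam_ge (U : nat -> set T) : A `<=` \bigcup_k U k ->
  (forall k, diam d (U k) <= 1%:E)%E ->
  ((2^-1)%:E <= \sum_(0 <= k <oo | U k != set0) diam d (U k))%E.
Proof.
move=> AU dU.
have dfin k : diam d (U k) = (fine (diam d (U k)))%:E.
  by rewrite fineK// ge0_fin_numE ?diam_ge0// (le_lt_trans (dU k))// ltry.
have r0 k : 0 <= fine (diam d (U k)) by rewrite -lee_fin -dfin diam_ge0.
have /choice[c Hc] k : exists c : R,
    forall x, U k x -> c - fine (diam d (U k)) <= p x <= c + fine (diam d (U k)).
  have [[z Uz]|/set0P/negP/negPn/eqP U0] := pselect (U k !=set0); last first.
    by exists 0 => x; rewrite U0.
  exists (p z) => x Ux; rewrite -ler_distl.
  by apply: le_trans (p_lip _ _) _; rewrite -lee_fin -dfin le_diam.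
pose I k : set R := if U k == set0 then set0 else
  `[c k - fine (diam d (U k)), c k + fine (diam d (U k))]%classic.
have I_le k : (lebesgue_measure (I k) <=
    2%:E * (if U k != set0 then diam d (U k) else 0))%E.
  rewrite /I; case: ifP => U0; first by rewrite measure0 /= mule0.
  have /= -> := @lebesgue_measure_itv R `[c k - fine (diam d (U k)), c k + fine (diam d (U k))].
  rewrite dfin -EFinM; case: ifP => _.
    by rewrite -EFinB lee_fin; lra.
  by rewrite lee_fin mulr_ge0.
have mI k : measurable (I k) by rewrite /I; case: ifP.
have sub : `[a, a + 1]%classic `<=` \bigcup_k I k.
  move=> t; rewrite /= in_itv /= => /p_onto[x /AU[k _ Ukx] <-].
  exists k => //; rewrite /I; case: ifPn => [/eqP U0|_]; first by rewrite U0 in Ukx.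
  by rewrite /= in_itv /= Hc.
have := measure_sigma_subadditive (@lebesgue_measure R) mI (measurable_itv _) sub.
have /= -> := @lebesgue_measure_itv R `[a, a + 1]; rewrite lte_fin ltrDl ltr01 -EFinB addrAC subrr add0r => le1.
rewrite -(@lee_pmul2l _ 2%:E) ?lte_fin// -EFinM divff ?pnatr_eq0//.
apply: (le_trans le1); rewrite [X in (_ <= _ * X)%E]eseries_mkcond -nneseriesZl.
  by apply: lee_nneseries => k *; [exact: measure_ge0 | exact: I_le].
by move=> k _; case: ifP => // _; exact: diam_ge0.
Qed.

(** For [s < 1] and diameters at most 1, [r^s >= r], so the sums of powers
    inherit the lower bound for sums of diameters. *)
Lemma hausdorff_dim_ge1 : (1%:E <= hausdorff_dim d A)%E.
Proof.
apply: le_ereal_inf_tmp => _ [s [s0 As] <-]; rewrite lee_fin leNgt; apply/negP => s1.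
suff : ((2^-1)%:E <= hausdorff_measure d s A)%E.
  by rewrite As lee_fin; lra.
apply: le_ereal_sup_tmp; exists (hausdorff_premeasure d s 1 A).
  by exists 1 => //=.
apply: le_ereal_inf_tmp => _ [U [AU dU] <-].
apply: le_trans (sum_diam_ge AU dU) _.
apply: lee_nneseries => [k _ _|k _]; first exact: diam_ge0.
move: (dU k) (diam_ge0 d (U k)); case: (diam d (U k)) => //= r.
rewrite !lee_fin => r1; rewrite le_eqVlt => /predU1P[<-|rgt0].
  by rewrite powR_ge0.
by rewrite ger1_powR ?rgt0 ?(ltW s1).
Qed.

End DimensionBounds.

Section SegmentContent.
Context {R : realType} {T : Type}.
Variables (d : T -> T -> R) (s : R).
Hypothesis s_gt1 : 1 < s.

(** Cut the range of the coordinate into [n + 1] pieces: the sum [(n + 1) (n +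
    1)^-s] is as small as desired. *)
Lemma hausdorff_content_unit_segment (A : set T) (p : T -> R) (a : R) :
  (forall x, A x -> a <= p x < a + 1) ->
  (forall x y, A x -> A y -> d x y <= `|p x - p y|) -> hausdorff_content d s A = 0%E.
Proof.
move=> Ap dp.
have s0 : 0 < s by exact: lt_trans s_gt1.
apply: hausdorff_content_eq0 => // e e0.
have s10 : 0 < s - 1 by rewrite subr_gt0.
have [n nlarge] : exists n : nat, n.+1%:R * (n.+1%:R^-1) `^ s <= e.
  have [n nl] : exists n : nat, e^-1 `^ (s - 1)^-1 <= n.+1%:R :> R.
    exists (Num.truncn (e^-1 `^ (s - 1)^-1)).
    by rewrite ltW// truncnS_gt.
  exists n; rewrite -powR_inv1// -powRrM mulN1r powRN.
  have n0 : 0 < n.+1%:R :> R by rewrite ltr0n.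
  rewrite -{1}(mulfK (lt0r_neq0 n0) n.+1%:R) -mulrA.
  rewrite (_ : _ * _ = (n.+1%:R `^ (s - 1))^-1); last first.
    rewrite powRB ?gt_eqF ?implybT// powRr1 ?(ltW n0)//; field.
    by rewrite !gt_eqF ?powR_gt0.
  rewrite -[e]invrK lef_pV2 ?posrE ?invr_gt0 ?powR_gt0//.
  have := @ge0_ler_powR R (s - 1) (ltW s10) (e^-1 `^ (s - 1)^-1) n.+1%:R.
  rewrite !nnegrE powR_ge0 ler0n => /(_ isT isT nl).
  by rewrite -powRrM mulVf ?gt_eqF// powRr1// invr_ge0 ltW.
have n0 : 0 < n.+1%:R :> R by rewrite ltr0n.
pose B k := [set x | A x /\ (k < n.+1)%N /\ a + k%:R / n.+1%:R <= p x < a + k.+1%:R / n.+1%:R].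
have AB : A `<=` \bigcup_k B k.
  move=> x Ax; have /andP[ap pa] := Ap _ Ax.
  have t0 : 0 <= (p x - a) * n.+1%:R by rewrite mulr_ge0 ?subr_ge0// ltW.
  have /andP[k1 k2] := truncn_itv t0.
  exists (Num.truncn ((p x - a) * n.+1%:R)) => //; split => //; split.
    rewrite -(ltr_nat R); apply: le_lt_trans k1 _.
    by rewrite gtr_pMl// ltrBlDl.
  by rewrite -lerBrDl -ltrBlDl ler_pdivrMr// ltr_pdivlMr// k1.
apply: le_trans (hausdorff_content_mono _ _ AB) _.
apply: (@hausdorff_content_bigcup_le _ _ _ _ _ (fun k => if (k < n.+1)%N then (n.+1%:R^-1) `^ s else 0)).
  move=> k; case: ifPn => kn; last first.
    rewrite (_ : B k = set0) ?hausdorff_content0//.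
    by apply/seteqP; split => // x [_ [kn' _]]; rewrite kn' in kn.
  apply: hausdorff_content_diam_le => // x y [Ax [_ /andP[x1 x2]]] [Ay [_ /andP[y1 y2]]].
  apply: le_trans (dp _ _ Ax Ay) _.
  have E : k.+1%:R / n.+1%:R = k%:R / n.+1%:R + n.+1%:R^-1 :> R.
    by rewrite -natr1 mulrDl mul1r.
  rewrite E addrA in x2 y2.
  rewrite ler_distl; apply/andP; split.
    by rewrite lerBlDr ltW// (lt_le_trans y2)// lerD2r.
  by rewrite ltW// (lt_le_trans x2)// lerD2r.
move=> m; rewrite -big_mkcond /=; apply: le_trans nlarge.
rewrite big_const_seq iter_addr_0 -[leLHS]mulr_natl; apply: ler_wpM2r; rewrite ?powR_ge0// ler_nat.
rewrite -size_filter; set l := seq.filter _ _.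
have : uniq l by rewrite filter_uniq// iota_uniq.
move=> ul; have /(uniq_leq_size ul) : {subset l <= iota 0 n.+1}.
  by move=> i; rewrite mem_filter mem_iota /= => /andP[+ _].
by rewrite size_iota.
Qed.

End SegmentContent.


(** * The Schwarz-Pick inequality for the exponential on half-strips *)

Section SchwarzPickReal.
Context {R : realType}.
Implicit Types y a g h : R.

(** The two conditions under which [g] bounds the contraction of the
    logarithm, in the hyperbolic metric of the half-plane, at points whose
    height in the strip is at least [h]. *)
Definition contracting g h :=
  forall t, h <= t <= pi -> sin t <= g * t /\ cos t <= g.

Lemma contracting1 : contracting 1 0.
Proof. by move=> t /andP[t0 _]; rewrite mul1r sin_le// cos_le1. Qed.

Lemma sin_lt_id h : 0 < h <= pi / 2 -> sin h < h.
Proof.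
move=> /andP[h0 hpi].
have p0 := @pi_gt0 R.
have : h / 2 * cos (h / 2) <= sin (h / 2) by apply: mul_cos_le_sin; lra.
have s2 : sin (h / 2) <= h / 2 by apply: sin_le; lra.
have c1 : cos (h / 2) < 1.
  by rewrite -[ltRHS](@cos0 R) ltr_cos ?in_itv /= ?pi_ge0 ?lexx /=; lra.
have -> : sin h = 2 * (cos (h / 2) * sin (h / 2)).
  by rewrite {1}(_ : h = (h / 2) *+ 2); [rewrite sin_mulr2n; ring|lra].
have sp : 0 < sin (h / 2) by apply: sin_gt0_pi; lra.
by nra.
Qed.

(** The best constant is [sin h / h]: sinc decreases, and [cos h] is smaller
    than it. The maximum with 1/2 serves the half-strips away from the real
    axis, where the contraction is never needed to be better. *)
Lemma contracting_exists h : 0 < h <= pi / 2 ->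
  exists g, [/\ 2^-1 <= g, g < 1 & contracting g h].
Proof.
move=> /andP[h0 hpi]; have p0 := @pi_gt0 R.
have sh : sin h < h by rewrite sin_lt_id// h0.
exists (Num.max 2^-1 (sin h / h)); split.
- by rewrite le_max lexx.
- by rewrite gt_max ltr_pdivrMr// mul1r sh andbT; lra.
move=> t /andP[ht tpi].
have m : sin h / h <= Num.max 2^-1 (sin h / h) by rewrite le_max lexx orbT.
split; last first.
  apply: le_trans m; rewrite ler_pdivlMr//.
  have : cos t <= cos h.
    move: ht; rewrite le_eqVlt => /predU1P[->//|ht].
    by apply: ltW; rewrite ltr_cos ?in_itv /=; lra.
  move=> cth; apply: le_trans (ler_wpM2r (ltW h0) cth) _.
  by rewrite mulrC mul_cos_le_sin //; lra.
have t0 : 0 < t by exact: lt_le_trans ht.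
rewrite -ler_pdivrMr//; apply: le_trans m; rewrite ler_pdivrMr// mulrAC ler_pdivlMr//.
by rewrite mulrC [leRHS]mulrC sinc_decreasing// ltW.
Qed.

(** With [u] and [v] the half-difference and half-sum of the heights, both
    products of heights become [v^2 - u^2] and [sin^2 v - sin^2 u], so the
    claim for the vertical part is a comparison of sinc at [u] and at [v = u +
    y2]. *)
Lemma schwarz_pick_strip g h a y1 y2 : 2^-1 <= g <= 1 -> 0 <= h ->
  contracting g h -> 0 <= a -> h <= y1 <= pi -> h <= y2 <= pi ->
  (a + (y1 - y2) ^+ 2) * (sin y1 * sin y2) <=
    g ^+ 2 * (a + 2 * (1 - cos (y1 - y2))) * (y1 * y2).
Proof.
move=> g1 h0 gh a0.
wlog y21 : y1 y2 / y2 <= y1 => [H|].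
  have [|/ltW] := leP y2 y1; first exact: H.
  move=> /H + b1 b2 => /(_ b2 b1); rewrite [y2 * _]mulrC [sin y2 * _]mulrC.
  by rewrite -(opprB y1 y2) sqrrN cosN.
move=> /andP[hy1 y1p] /andP[hy2 y2p].
have [s1 _] : sin y1 <= g * y1 /\ cos y1 <= g by apply: gh; rewrite hy1.
have [s2 c2] : sin y2 <= g * y2 /\ cos y2 <= g by apply: gh; rewrite hy2.
have y1_0 := le_trans h0 hy1; have y2_0 := le_trans h0 hy2.
have sy1 : 0 <= sin y1 by rewrite sin_ge0_pi// y1_0.
have sy2 : 0 <= sin y2 by rewrite sin_ge0_pi// y2_0.
have ss : sin y1 * sin y2 <= g ^+ 2 * (y1 * y2).
  by rewrite (_ : g ^+ 2 * _ = (g * y1) * (g * y2)); [exact: ler_pM|ring].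
have u0 : 0 <= (y1 - y2) / 2 by rewrite divr_ge0// subr_ge0.
have vE : (y1 + y2) / 2 = (y1 - y2) / 2 + y2 by lra.
have H : (y1 - y2) / 2 * sin ((y1 + y2) / 2) <=
    g * ((y1 + y2) / 2) * sin ((y1 - y2) / 2).
  by rewrite vE; apply: sinc_contraction => //; lra.
rewrite one_sub_cos; move: H ss; rewrite sin_sqr_diff.
rewrite (_ : y1 * y2 = ((y1 + y2) / 2) ^+ 2 - ((y1 - y2) / 2) ^+ 2); last by field.
rewrite (_ : (y1 - y2) ^+ 2 = 4 * ((y1 - y2) / 2) ^+ 2); last by field.
have su : 0 <= sin ((y1 - y2) / 2) by apply: sin_ge0_pi; lra.
have sv : 0 <= sin ((y1 + y2) / 2) by apply: sin_ge0_pi; lra.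
have v0 : 0 <= (y1 + y2) / 2 by lra.
move: u0 v0 su sv; move: ((y1 - y2) / 2) ((y1 + y2) / 2) => u v.
move: (sin u) (sin v) => su sv u0 v0 su0 sv0 H ss.
have H2 : (u * sv) ^+ 2 <= (g * v * su) ^+ 2.
  by rewrite lerXn2r ?nnegrE ?mulr_ge0//; lra.
have g2 : g ^+ 2 <= 1 by rewrite expr_le1//; lra.
have K : g ^+ 2 * (u * su) ^+ 2 <= (u * su) ^+ 2 by rewrite ler_piMl// sqr_ge0.
rewrite -subr_ge0 (_ : _ - _ = a * (g ^+ 2 * (v ^+ 2 - u ^+ 2) - (sv ^+ 2 - su ^+ 2))
  + 4 * (((g * v * su) ^+ 2 - (u * sv) ^+ 2) + ((u * su) ^+ 2 - g ^+ 2 * (u * su) ^+ 2))); last by ring.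
apply: addr_ge0; apply: mulr_ge0 => //; first by rewrite subr_ge0.
by apply: addr_ge0; rewrite subr_ge0.
Qed.

(** Outside the two half-strips adjacent to the real axis both heights are at
    least [pi], while the sines are at most 1: the crude bound
    [one_sub_cos_ge] already gives a factor 4 in squared distance. *)
Lemma schwarz_pick_real g h a y1 y2 : 2^-1 <= g <= 1 -> 0 <= h ->
  contracting g h -> 0 <= a -> h <= `|y1| -> h <= `|y2| ->
  0 < y1 * y2 -> 0 < sin y1 * sin y2 -> `|y1 - y2| <= pi ->
  (a + (y1 - y2) ^+ 2) * (sin y1 * sin y2) <=
    g ^+ 2 * (a + 2 * (1 - cos (y1 - y2))) * (y1 * y2).
Proof.
move=> g1 h0 gh a0; have p0 := @pi_gt0 R.
wlog y1_0 : y1 y2 / 0 < y1 => [H|].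
  have [|y10 hy1 hy2 yy ss yp] := ltP 0 y1; first exact: H.
  have := H (- y1) (- y2).
  rewrite !sinN !normrN !mulrNN -opprD normrN sqrrN cosN; apply => //.
  rewrite oppr_gt0 lt_neqAle y10 andbT; apply: contraTneq yy => ->.
  by rewrite mul0r ltxx.
move=> hy1 hy2; rewrite pmulr_rgt0// => y2_0.
move: hy1 hy2; rewrite (gtr0_norm y1_0) (gtr0_norm y2_0) => hy1 hy2 ss yp.
(* The signs of the sines and the distance exclude one height below [pi]
   and the other above. *)
have near_strip (z w : R) : 0 < z -> z < pi -> 0 < sin z * sin w -> 0 < w -> `|z - w| <= pi -> w < pi.
  move=> z0 zpi szw w0; rewrite ler_norml => /andP[zw _]; rewrite ltNge; apply/negP => wpi.
  have sz : 0 < sin z by apply: sin_gt0_pi; rewrite z0.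
  have : 0 <= sin (w - pi) by apply: sin_ge0_pi; lra.
  rewrite sinB sinpi cospi mulr0 subr0 mulrN1 oppr_ge0 leNgt => /negP; apply.
  by rewrite pmulr_rgt0 in szw.
have [y1p|y1p] := ltP y1 pi.
  by apply: (@schwarz_pick_strip g h) => //; rewrite ?hy1 ?hy2 ?ltW//= (near_strip y1).
have y2p : pi <= y2.
  rewrite leNgt; apply/negP => y2p.
  have : y1 < pi by apply: (near_strip y2) => //; rewrite 1?mulrC 1?distrC.
  by rewrite ltNge y1p.
have ppi : pi ^+ 2 <= y1 * y2 by rewrite expr2 ler_pM// ltW.
have p4 : 4 <= pi ^+ 2 :> R.
  by rewrite (_ : 4 = 2 ^+ 2) ?lerXn2r ?nnegrE ?pi_ge2 ?ltW//; lra.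
have g4 : 4^-1 <= g ^+ 2.
  by rewrite (_ : 4^-1 = 2^-1 ^+ 2) ?lerXn2r ?nnegrE; lra.
have s1 : sin y1 * sin y2 <= 1.
  apply: le_trans (ler_norm _) _; rewrite normrM.
  by rewrite mulr_ile1 ?sin_max.
have C := one_sub_cos_ge yp.
set D := (y1 - y2) ^+ 2 in C *.
have D0 : 0 <= D by exact: sqr_ge0.
have c0 : 0 <= 1 - cos (y1 - y2) by rewrite subr_ge0 cos_le1.
apply: (@le_trans _ _ (a + D)).
  by rewrite ler_piMr// addr_ge0.
apply: (@le_trans _ _ (4^-1 * (a + 2 * (1 - cos (y1 - y2))) * pi ^+ 2)); last first.
  rewrite ler_pM ?sqr_ge0 ?mulr_ge0 ?addr_ge0 ?mulr_ge0// ler_wpM2r//.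
  by rewrite addr_ge0// mulr_ge0.
have : a * 4 <= a * pi ^+ 2 by rewrite ler_wpM2l.
by move: C; move: (1 - cos _) (pi ^+ 2) => c p; lra.
Qed.

End SchwarzPickReal.


(** * Expansion of pairs of points under the exponential *)

Section ExpPairs.
Context {R : realType}.
Local Notation Re := (@complex.Re R).
Local Notation Im := (@complex.Im R).
Implicit Types z w : R[i].

Lemma Re_cexp z : Re (cexp z) = expR (Re z) * cos (Im z).
Proof. by case: z => x y; rewrite /cexp /= mul0r subr0. Qed.

Lemma Im_cexp z : Im (cexp z) = expR (Re z) * sin (Im z).
Proof. by case: z => x y; rewrite /cexp /= mul0r addr0. Qed.

Definition dist2 z w := (Re z - Re w) ^+ 2 + (Im z - Im w) ^+ 2.

Lemma dist2_ge0 z w : 0 <= dist2 z w.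
Proof. by rewrite addr_ge0// sqr_ge0. Qed.

Lemma cdistE z w : cdist z w = Num.sqrt (dist2 z w).
Proof. by case: z w => x y [x' y']. Qed.

Lemma cdist_le z w r : 0 <= r -> dist2 z w <= r ^+ 2 -> cdist z w <= r.
Proof.
move=> r0 h; rewrite cdistE -(ger0_norm r0) -sqrtr_sqr.
exact: ler_wsqrtr.
Qed.

Lemma Re_lipschitz z w : `|Re z - Re w| <= cdist z w.
Proof. by rewrite cdistE -sqrtr_sqr ler_wsqrtr// lerDl sqr_ge0. Qed.

Lemma norm2_cexp z : Re (cexp z) ^+ 2 + Im (cexp z) ^+ 2 = expR (Re z) ^+ 2.
Proof. by rewrite Re_cexp Im_cexp !exprMn -mulrDr cos2Dsin2 mulr1. Qed.

Lemma dist2_cexp z w : dist2 (cexp z) (cexp w) =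
  expR (Re z + Re w) * (expR (Re z - Re w) + expR (- (Re z - Re w)) - 2 +
    2 * (1 - cos (Im z - Im w))).
Proof.
rewrite /dist2 !Re_cexp !Im_cexp cosB opprB !expRD !expRN.
have ez : expR (Re z) != 0 by rewrite gt_eqF// expR_gt0.
have ew : expR (Re w) != 0 by rewrite gt_eqF// expR_gt0.
have E1 := cos2Dsin2 (Im z); have E2 := cos2Dsin2 (Im w).
move: (expR (Re z)) (expR (Re w)) (cos (Im z)) (sin (Im z)) (cos (Im w))
  (sin (Im w)) ez ew E1 E2 => a b c1 s1 c2 s2 a0 b0 E1 E2.
transitivity (a ^+ 2 * (c1 ^+ 2 + s1 ^+ 2) + b ^+ 2 * (c2 ^+ 2 + s2 ^+ 2)
  - 2 * a * b * (c1 * c2 + s1 * s2)); first by ring.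
by rewrite E1 E2; field; rewrite a0 b0.
Qed.

(** The modulus of [exp z - exp w] is that of the exponential at the midpoint
    times that of [2 sinh ((z - w) / 2)]; the bounds [sinh t >= t] and, for
    heights at most [pi] apart, [sin t >= 2 t / pi] finish the proof. *)
Lemma dist2_cexp_ge z w : `|Im z - Im w| <= pi ->
  4 * expR (Re z + Re w) * dist2 z w <= dist2 (cexp z) (cexp w) * pi ^+ 2.
Proof.
move=> yp; rewrite dist2_cexp.
have C := one_sub_cos_ge yp.
have S := sqr_le_cosh (Re z - Re w).
have p4 : 4 <= pi ^+ 2 :> R.
  by rewrite (_ : 4 = 2 ^+ 2) ?lerXn2r ?nnegrE ?pi_ge2 ?pi_ge0//; lra.
rewrite mulrAC mulrC -!mulrA ler_pM2l ?expR_gt0// /dist2.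
set u := expR _ + _ - _ in S *.
have := ler_wpM2l (le_trans (sqr_ge0 _) S) p4.
by move: S C; move: (_ ^+ 2) (_ ^+ 2) (1 - _) (pi ^+ 2) => a b v p; lra.
Qed.

(** The two points lie in a common half-strip between consecutive multiples of
    [pi], stated by signs because this is the form that propagates backwards
    along orbits. *)
Definition same_half z w := [/\ 0 < Im z * Im w,
  0 < Im (cexp z) * Im (cexp w) & `|Im z - Im w| <= pi].

Lemma Im_cexpM z w : Im (cexp z) * Im (cexp w) =
  expR (Re z + Re w) * (sin (Im z) * sin (Im w)).
Proof. by rewrite !Im_cexp expRD; ring. Qed.

(** [4 sinh^2 (rho / 2)], where [rho] is the hyperbolic distance in the upper
    or lower half-plane that contains both points. *)
Definition hyp2 z w := dist2 z w / (Im z * Im w).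

Lemma hyp2_contract g h z w : 2^-1 <= g <= 1 -> 0 <= h -> contracting g h ->
  h <= `|Im z| -> h <= `|Im w| -> same_half z w ->
  hyp2 z w <= g ^+ 2 * hyp2 (cexp z) (cexp w).
Proof.
move=> g1 h0 gh hz hw [yy ss yp]; rewrite /hyp2 mulrA ler_pdivlMr// mulrAC ler_pdivrMr//.
move: ss; rewrite Im_cexpM pmulr_rgt0 ?expR_gt0// => ss.
set a := expR (Re z - Re w) + expR (- (Re z - Re w)) - 2.
have S := sqr_le_cosh (Re z - Re w).
have a0 : 0 <= a by apply: le_trans S; exact: sqr_ge0.
have := schwarz_pick_real g1 h0 gh a0 hz hw yy ss yp.
rewrite -(ler_pM2l (expR_gt0 (Re z + Re w))) dist2_cexp -/a => H.
apply: le_trans (_ : _ <= expR (Re z + Re w) * ((a + (Im z - Im w) ^+ 2) * (sin (Im z) * sin (Im w)))) _.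
  rewrite [leLHS]mulrCA ler_pM2l ?expR_gt0// ler_pM2r// lerD2r.
  exact: S.
by apply: le_trans H _; rewrite le_eqVlt; apply/orP; left; apply/eqP; ring.
Qed.

Lemma hyp2_le z w : same_half z w -> hyp2 z w <= hyp2 (cexp z) (cexp w).
Proof.
move=> zw; rewrite -[leRHS]mul1r -[1](expr1n _ 2).
by apply: hyp2_contract contracting1 _ _ _ => //; lra.
Qed.

(** The contraction factor at a point depends on its height, here bounded
    below only for [z]; a bound on the hyperbolic distance to [z] bounds the
    height of [w] from below as well. *)
Lemma hyp2_gain (C : R) : 0 <= C -> exists g : R, [/\ 0 < g, g < 1 &
  forall z w, same_half z w -> pi / 4 <= `|Im z| -> hyp2 z w <= C ->
    hyp2 z w <= g * hyp2 (cexp z) (cexp w)].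
Proof.
move=> C0; have p0 := @pi_gt0 R.
have C2 : 0 < C + 2 by lra.
(* [(y - y')^2 <= C y y'] implies [y <= (C + 2) y']. *)
pose h : R := pi / 4 / (C + 2).
have h0 : 0 < h by rewrite !divr_gt0.
have h8 : h <= pi / 4 by rewrite ler_pdivrMr// ler_peMr//; lra.
have [|g [g2 g1 gh]] := @contracting_exists _ h; first by lra.
exists (g ^+ 2); split; first by rewrite exprn_gt0//; lra.
  by rewrite expr_lt1//; lra.
move=> z w zw hz zwC; have [yy _ _] := zw.
apply: hyp2_contract gh _ _ zw; try lra.
move: zwC; rewrite /hyp2 ler_pdivrMr// => H.
have {H} : (Im z - Im w) ^+ 2 <= C * (Im z * Im w).
  by apply: le_trans H; rewrite lerDr sqr_ge0.
rewrite -(gtr0_norm yy) normrM => H.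
have : `|Im z| ^+ 2 <= (C + 2) * (`|Im z| * `|Im w|).
  have := sqr_ge0 (`|Im w|); have : `|Im z| * `|Im w| = Im z * Im w by rewrite -normrM gtr0_norm.
  move: H; rewrite sqrrB.
  rewrite -(real_normK (num_real (Im z))) -(real_normK (num_real (Im w))).
  by lra.
rewrite expr2 mulrCA ler_pM2l => [zw|]; last by lra.
by rewrite /h ler_pdivrMr// [leRHS]mulrC; exact: le_trans zw.
Qed.

(** The exponential maps a half-strip onto a half-plane, and Euclidean
    distances in the half-strip are controlled by hyperbolic distances in that
    half-plane since the density [1 / sin] is at least 1. *)
Lemma dist2_le_hyp2 z w : same_half z w ->
  4 * dist2 z w <= pi ^+ 2 * hyp2 (cexp z) (cexp w).
Proof.
move=> [_ ss yp]; have H := dist2_cexp_ge yp.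
rewrite /hyp2 mulrA ler_pdivlMr// [pi ^+ 2 * _]mulrC; apply: le_trans H.
rewrite Im_cexpM [leLHS](_ : _ = 4 * expR (Re z + Re w) * dist2 z w *
  (sin (Im z) * sin (Im w))); last by ring.
apply: ler_piMr.
  by rewrite !mulr_ge0 ?dist2_ge0 ?expR_ge0.
apply: le_trans (ler_norm _) _; rewrite normrM.
by rewrite mulr_ile1 ?sin_max.
Qed.

End ExpPairs.


(** * Pairs of orbits with the same itinerary *)

Section Orbits.
Context {R : realType}.
Local Notation Re := (@complex.Re R).
Local Notation Im := (@complex.Im R).
Local Notation orb n z := (iter n (@cexp R) z).
Implicit Types (z w : R[i]) (c : nat -> int).

Lemma sin_sub_int (k : int) (y : R) : sin (y - 2 * k%:~R * pi) = sin y.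
Proof.
have P (n : nat) (t : R) : sin (t + n%:R * (pi *+ 2)) = sin t.
  elim: n t => [|n IH] t; first by rewrite mul0r addr0.
  by rewrite -natr1 mulrDl mul1r addrA sinD2pi IH.
case: k => n.
  by rewrite -[LHS](P n); congr sin; rewrite -pmulrn; ring.
rewrite NegzE mulrNz -[RHS](P n.+1); congr sin.
by rewrite -pmulrn; ring.
Qed.

(** The sign of the imaginary part of the image tells in which half of the
    strip the point lies. *)
Lemma strip_same_half (k : int) z w : strip R k z -> strip R k w ->
  0 < Im (cexp z) * Im (cexp w) -> same_half z w.
Proof.
have p0 := @pi_gt0 R.
move=> /andP[z1 z2] /andP[w1 w2] zw.
have : 0 < sin (Im z - 2 * k%:~R * pi) * sin (Im w - 2 * k%:~R * pi).
  by rewrite !sin_sub_int; move: zw; rewrite Im_cexpM pmulr_rgt0 ?expR_gt0.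
have : 0 < (Im z - 2 * k%:~R * pi) * (Im w - 2 * k%:~R * pi) ->
    `|Im z - Im w| <= pi -> same_half z w.
  move=> tt yp; split => //.
  have [k0|k0|k0] := ltgtP k 0.
  - have kR : k%:~R + 1 <= 0 :> R.
      by rewrite -[1]/(1%:~R) -intrD -[0]/(0%:~R) ler_int lezD1.
    have : (2 * k%:~R + 1) * pi < 0 :> R.
      by rewrite -oppr_gt0 -mulNr mulr_gt0//; lra.
    by move=> k2; rewrite nmulr_rgt0; [exact: le_lt_trans k2|exact: le_lt_trans k2].
  - have : 1 <= k%:~R :> R by rewrite -[1]/(1%:~R) ler_int.
    move=> kR; have : 0 < (2 * k%:~R - 1) * pi :> R by rewrite mulr_gt0//; lra.
    by move=> k2; rewrite mulr_gt0//; exact: lt_trans k2 _.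
  - by move: tt; rewrite k0 mulr0 mul0r !subr0.
have Kp : (2 * k%:~R + 1) * pi = 2 * k%:~R * pi + pi :> R by ring.
have Km : (2 * k%:~R - 1) * pi = 2 * k%:~R * pi - pi :> R by ring.
move: z1 z2 w1 w2; rewrite Kp Km.
move: (2 * k%:~R * pi : R) => K z1 z2 w1 w2 H.
have pos (t : R) : - pi < t -> t <= pi -> 0 < sin t -> 0 < t.
  move=> t1 t2; apply: contraTT; rewrite -!leNgt => t0.
  by rewrite -oppr_ge0 -sinN sin_ge0_pi//; lra.
have neg (t : R) : - pi < t -> t <= pi -> sin t < 0 -> t < 0.
  move=> t1 t2; apply: contraTT; rewrite -!leNgt => t0.
  by rewrite sin_ge0_pi//; lra.
have [sz|sz|->] := ltgtP (sin (Im z - K)) 0; last by rewrite mul0r ltxx.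
  rewrite nmulr_rgt0// => sw.
  have tz : Im z - K < 0 by apply: neg sz; lra.
  have tw : Im w - K < 0 by apply: neg sw; lra.
  by apply: H; [rewrite nmulr_rgt0 | rewrite ler_norml; apply/andP; split; lra].
rewrite pmulr_rgt0// => sw.
have tz : 0 < Im z - K by apply: pos sz; lra.
have tw : 0 < Im w - K by apply: pos sw; lra.
by apply: H; [rewrite pmulr_rgt0 | rewrite ler_norml; apply/andP; split; lra].
Qed.

(** Backwards induction: the half-planes containing the two points at time [k
    + 1] determine their half-strips at time [k], hence their half-planes at
    time [k]. One sign, at the last time, thus fixes the whole inverse branch. *)
Lemma itinerary_same_half c z w n :
  itinerary_set R c z -> itinerary_set R c w ->
  0 < Im (orb n z) * Im (orb n w) ->
  forall k, (k < n)%N -> same_half (orb k z) (orb k w).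
Proof.
move=> zc wc; elim: n => // n IH zw k.
have H : same_half (orb n z) (orb n w).
  by apply: strip_same_half (zc n) (wc n) _; rewrite -!iterS.
rewrite ltnS leq_eqVlt => /predU1P[->//|]; apply: IH.
by have [] := H.
Qed.

(** Pulling back through a point at height at least [pi / 4] contracts by a
    definite factor; the bound on the real part keeps the image of the point
    away from the singularity 0 of the logarithm. *)
Definition good z k :=
  (pi / 4 <= `|Im (orb k z)|) && (-1 <= Re (orb k z)).

Definition good_count z n := (\sum_(1 <= k < n) good z k)%N.

Lemma good_countS z n : good_count z n.+2 = (good_count z n.+1 + good z n.+1)%N.
Proof. by rewrite /good_count big_nat_recr. Qed.

Lemma good_count_mono z m n : (m <= n)%N -> (good_count z m <= good_count z n)%N.
Proof.
move=> mn; rewrite /good_count; have [m1|m1] := leqP 1 m.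
  by rewrite (@big_cat_nat _ _ _ m 1 n) //= leq_addr.
by rewrite big_geq // ltnW.
Qed.

(** The hyperbolic distance only decreases under pullback, so that the bound
    [C] required by the gain holds at all earlier times once it holds at the
    last one. *)
Lemma hyp2_chain (C g : R) : 0 < g ->
  (forall z w, same_half z w -> pi / 4 <= `|Im z| -> hyp2 z w <= C ->
    hyp2 z w <= g * hyp2 (cexp z) (cexp w)) ->
  forall n z w, (forall k, (k <= n)%N -> same_half (orb k z) (orb k w)) ->
  hyp2 (orb n.+1 z) (orb n.+1 w) <= C ->
  hyp2 (cexp z) (cexp w) <= g ^+ good_count z n.+1 * hyp2 (orb n.+1 z) (orb n.+1 w).
Proof.
move=> g0 gain; elim=> [|n IH] z w sh leC.
  by rewrite /good_count big_geq// expr0 mul1r.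
have sh1 := sh n.+1 (leqnn _).
have le1 := hyp2_le sh1; rewrite -!iterS in le1.
have leC1 := le_trans le1 leC.
apply: le_trans (IH z w (fun k kn => sh k (leqW kn)) leC1) _.
rewrite good_countS exprD -mulrA ler_pM2l ?exprn_gt0//.
case: (boolP (good z n.+1)) => [/andP[h _]|_]; last by rewrite expr0 mul1r.
by rewrite expr1; have := gain _ _ sh1 h leC1; rewrite -!iterS.
Qed.

End Orbits.


(** * Orbits near the real axis *)

Section Growth.
Context {R : realType}.
Local Notation Re := (@complex.Re R).
Local Notation Im := (@complex.Im R).
Local Notation orb n z := (iter n (@cexp R) z).
Implicit Types (z w : R[i]).

(** Tangents of the exponential at 0 and 1; the margin 1/8 is what makes
    orbits near the real axis move to the right. *)
Lemma expR_ge_affine (x : R) : 2 * x + 8^-1 <= expR x.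
Proof.
have [x1|x1] := leP x (1 / 2); first by apply: le_trans (expR_ge1Dx x); lra.
have e2 : 9 / 4 <= expR 1 :> R.
  have -> : expR 1 = expR (2^-1 + 2^-1) :> R by congr expR; field.
  rewrite expRD; have := expR_ge1Dx (2^-1 : R).
  by set e := expR _ => e1; nra.
have -> : expR x = expR 1 * expR (x - 1) by rewrite -expRD; congr expR; ring.
have := expR_ge1Dx (x - 1); have := expR_ge0 (x - 1).
by nra.
Qed.

Lemma narrow_cos (y : R) : `|y| < pi / 4 -> 2^-1 <= cos y.
Proof.
move=> yp; have p0 := @pi_gt0 R.
have c2 : 0 <= cos (y *+ 2).
  by apply: cos_ge0_pihalf; move: yp; rewrite ltr_norml; lra.
have c1 : 0 <= cos y by apply: cos_ge0_pihalf; move: yp; rewrite ltr_norml; lra.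
rewrite cos_mulr2n in c2.
by nra.
Qed.

Lemma narrow_growth z : `|Im z| < pi / 4 ->
  Num.max 0 (Re z + 16^-1) <= Re (cexp z).
Proof.
move=> /narrow_cos c; rewrite Re_cexp ge_max.
have e0 := expR_ge0 (Re z); have := expR_ge_affine (Re z).
have : 2^-1 * expR (Re z) <= expR (Re z) * cos (Im z) by rewrite mulrC ler_wpM2l.
by move: (_ * cos _) => u; lra.
Qed.

Lemma narrow_orbit_growth z n i :
  (forall k, (n <= k <= n + i)%N -> `|Im (orb k z)| < pi / 4) ->
  i%:R / 16 <= Re (orb (n + i).+1 z).
Proof.
elim: i => [|i IH] H.
  have := narrow_growth (H n _); rewrite leqnn leq_addr addn0 ge_max => /(_ isT).
  by rewrite mul0r -iterS => /andP[].
have := narrow_growth (H (n + i.+1)%N _); rewrite leqnn leq_addr ge_max => /(_ isT).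
move=> /andP[_]; rewrite -iterS addnS; apply: le_trans.
rewrite -natr1 mulrDl mul1r lerD2r; apply: IH => k /andP[nk ki].
by apply: H; rewrite nk addnS leqW.
Qed.

(** Near the axis real parts grow linearly, so from some time on the
    derivative is at least 4 and the distance to the axis at least doubles at
    each step, which is only possible if it is 0. *)
Lemma real_of_narrow z n : (forall k, (n <= k)%N -> `|Im (orb k z)| < pi / 4) ->
  exists k, Im (orb k z) = 0.
Proof.
move=> H; have p0 := @pi_gt0 R.
(* After 48 steps of growth 1/16 the real part is at least 3, and
   [expR 3 >= 4]. *)
pose m := (n + 48).+1; exists m; apply/eqP/negPn/negP => y0.
have mk i : (n <= m + i)%N by rewrite /m addSn leqW // -addnA leq_addr.
have D i : 2 ^+ i * `|Im (orb m z)| <= `|Im (orb (m + i) z)|.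
  elim: i => [|i IH]; first by rewrite expr0 mul1r addn0.
  rewrite addnS iterS Im_cexp normrM (ger0_norm (expR_ge0 _)) exprS -mulrA.
  apply: (@le_trans _ _ (2 * `|Im (orb (m + i) z)|)); first by rewrite ler_pM2l.
  have X : 3 <= Re (orb (m + i) z).
    have := @narrow_orbit_growth z n (48 + i) (fun k nk => H k (proj1 (andP nk))).
    rewrite addnA -addSn -/m natrD; have : 0 <= i%:R :> R by [].
    by lra.
  have e4 : 4 <= expR (Re (orb (m + i) z)) by apply: le_trans (expR_ge1Dx _); lra.
  have := H _ (mk i); move: (Im _) => y yp.
  have s : `|y| / 2 <= `|sin y|.
    have : `|y| * sin (pi / 2) <= pi / 2 * sin `|y| by apply: sinc_decreasing => //; lra.
    rewrite sin_pihalf mulr1 => H1.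
    have -> : `|sin y| = `|sin `|y| |.
      by have [y1|y1] := ger0P y; rewrite ?sinN ?normrN.
    have sy : 0 <= sin `|y| by apply: sin_ge0_pi; rewrite normr_ge0; lra.
    rewrite (ger0_norm sy); have := @pihalf_lt2 R; nra.
  by have := normr_ge0 y; nra.
have y1 : 0 < `|Im (orb m z)| by rewrite normr_gt0.
have [i Hi] : exists i : nat, pi / 4 / `|Im (orb m z)| <= i%:R.
  by exists (Num.truncn (pi / 4 / `|Im (orb m z)|)).+1; rewrite ltW // truncnS_gt.
have := H _ (mk i); rewrite ltNge => /negP; apply; apply: le_trans (D i).
rewrite -ler_pdivrMr//; apply: (le_trans Hi).
by rewrite -natrX ler_nat ltnW // ltn_expl.
Qed.

(** The only points at height [pi / 4] that are not good have real part below
    -1. A point with that real part is the image of one in the part of its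
    strip where the cosine is negative, and whose real part is positive. *)
Lemma good_of_negative z k : Re (orb k.+1 z) < -1 -> good z k.
Proof.
rewrite iterS Re_cexp => H; have p0 := @pi_gt0 R.
apply/andP; split.
  rewrite leNgt; apply/negP => /narrow_cos c.
  by have := mulr_ge0 (expR_ge0 (Re (orb k z))) (le_trans _ c); lra.
rewrite leNgt; apply/negP => x.
have : expR (Re (orb k z)) <= 1 by rewrite expR_le1; lra.
have := expR_ge0 (Re (orb k z)); have := cos_geN1 (Im (orb k z)).
by nra.
Qed.

Lemma good_infinitely_often z : (forall k, Im (orb k z) != 0) ->
  forall N, exists2 k, (N <= k)%N & good z k.
Proof.
move=> z0 N; apply: contrapT => H.
have [k /eqP] : exists k, Im (orb k z) = 0; last by rewrite (negbTE (z0 k)).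
apply: (@real_of_narrow z N.+1) => k Nk; rewrite ltNge; apply/negP => yk.
have [|x] := leP (-1) (Re (orb k z)).
  by move=> x; apply: H; exists k; [exact: ltnW | rewrite /good yk].
case: k Nk yk x => // k Nk yk x.
by apply: H; exists k => //; exact: good_of_negative.
Qed.

(** The derivative of the exponential times the height: the hyperbolic size at
    [z] of the pullback of a unit tile around [cexp z] is about its inverse. *)
Definition weight z := expR (Re z) * `|Im z|.

Lemma expR_ge_quarter (x : R) : -1 <= x -> 4^-1 <= expR x.
Proof.
move=> x1; apply: (@le_trans _ _ (expR (-1))); last by rewrite ler_expR.
have -> : -1 = - 2^-1 + - 2^-1 :> R by field.
rewrite expRD; have := expR_ge1Dx (- 2^-1 : R).
by set e := expR _ => e1; nra.
Qed.

Lemma weight_ge_tile z (n : nat) : pi / 4 <= `|Im z| -> -1 <= Re z ->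
  n%:R <= `|Re (cexp z)| -> n.+1%:R / 16 <= weight z.
Proof.
move=> y x nz.
have y2 : 2^-1 <= `|Im z| by have := @pi_ge2 R; lra.
have e4 := expR_ge_quarter x.
have n1 : n.+1%:R / 8 <= expR (Re z).
  case: n nz => [_|n nz]; first by lra.
  have : n.+1%:R <= expR (Re z).
    apply: (le_trans nz); rewrite Re_cexp normrM (ger0_norm (expR_ge0 _)).
    by rewrite ler_piMr ?expR_ge0 ?cos_max.
  have : 1 <= n.+1%:R :> R by rewrite ler1n.
  by rewrite -[n.+2%:R]natr1; lra.
have n0 : 0 <= n.+1%:R :> R by [].
by rewrite /weight; nra.
Qed.

(** Either the height is comparable to the modulus of [z], or the real part
    is, and then the exponential is at least as large. *)
Lemma weight_ge_norm z r : pi / 4 <= `|Im z| -> -1 <= Re z -> 0 <= r ->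
  r ^+ 2 <= Re z ^+ 2 + Im z ^+ 2 -> r / 16 <= weight z.
Proof.
move=> y x r0 rz.
have y2 : 2^-1 <= `|Im z| by have := @pi_ge2 R; lra.
have e4 := expR_ge_quarter x; have e1 := expR_ge1Dx (Re z).
have [yr|yr] := leP (r / 2) `|Im z|; first by rewrite /weight; nra.
have y2r : Im z ^+ 2 <= r ^+ 2 / 4.
  rewrite -(real_normK (num_real (Im z))).
  rewrite (_ : r ^+ 2 / 4 = (r / 2) ^+ 2); last by field.
  by rewrite lerXn2r ?nnegrE ?ltW//; lra.
have x2r : (r / 2) ^+ 2 <= Re z ^+ 2 by nra.
have [x0|x0] := leP 0 (Re z).
  have xr : r / 2 <= Re z by rewrite -ler_sqr ?nnegrE//; lra.
  by rewrite /weight; nra.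
have r2 : r <= 2 by nra.
by rewrite /weight; nra.
Qed.

(** Between times [N + 1] and [N + q - 1] the orbit is near the axis, so its
    real part grows to about [q / 16], and the modulus one step later is the
    exponential of that. *)
Lemma weight_ge_gap z N q : good z (N + q) ->
  (forall k, (N <= k < N + q)%N -> ~~ good z k) ->
  expR (q%:R / 16) / 32 <= weight (orb (N + q) z).
Proof.
move=> /andP[y x] H.
have E : expR (q%:R / 16) / 32 <= expR ((q%:R - 3) / 16) / 16 :> R.
  rewrite mulrBl expRD; have := expR_ge1Dx (- (3 / 16) : R).
  have := expR_gt0 (q%:R / 16 : R); set e := expR _; set e' := expR _.
  by nra.
apply: le_trans E _.
have narrow k : (N < k < N + q)%N -> `|Im (orb k z)| < pi / 4.
  move=> /andP[Nk kq]; rewrite ltNge; apply/negP => yk.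
  have := H k; rewrite kq ltnW// => /(_ isT); rewrite /good yk /= -ltNge.
  case: k Nk kq yk => // k Nk kq yk /good_of_negative gk.
  by have := H k; rewrite -ltnS Nk gk ltnW// => /(_ isT).
have [q3|q3] := ltnP q 3.
  apply: (@le_trans _ _ (1 / 16)); last first.
    have y2 : 2^-1 <= `|Im (orb (N + q) z)| by have := @pi_ge2 R; lra.
    by have := expR_ge_quarter x; rewrite /weight; nra.
  rewrite ler_pM2r// expR_le1 pmulr_lle0// subr_le0.
  by rewrite ler_nat ltnW.
have [i qE] : exists i, q = i.+3 by exists (q - 3)%N; rewrite -[in LHS](subnK q3) addn3.
have X := @narrow_orbit_growth z N.+1 i.
have {}X : i%:R / 16 <= Re (orb (N.+1 + i).+1 z).
  by apply: X => k /andP[k1 k2]; apply: narrow; rewrite k1 qE /= (leq_ltn_trans k2)// !addnS addSn.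
apply: weight_ge_norm => //.
rewrite qE !addnS iterS norm2_cexp -addSn.
rewrite lerXn2r ?nnegrE ?expR_ge0// ler_expR -addSn.
apply: le_trans X; rewrite -[i.+3%:R]natr1 -[i.+2%:R]natr1 -[i.+1%:R]natr1.
by lra.
Qed.

End Growth.


(** * Two convergent series *)

Section Series.
Context {R : realType}.

(** The derivative of [x^-p] is [- p x^-(p+1)]; the discrete version rests on
    [ln (b / a) >= 1 / b] for [b = a + 1]. *)
Lemma powR_telescope (p : R) (i : nat) : 0 < p ->
  (i.+2%:R `^ (p + 1))^-1 <= p^-1 * (i.+1%:R `^ (- p) - i.+2%:R `^ (- p)) :> R.
Proof.
move=> p0.
have a0 : 0 < i.+1%:R :> R by rewrite ltr0n.
have bE : i.+2%:R = i.+1%:R + 1 :> R by rewrite -[LHS]natr1.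
have b0 : 0 < i.+2%:R :> R by rewrite ltr0n.
move: a0 bE b0; move: (i.+1%:R : R) (i.+2%:R : R) => a b a0 bE b0.
have ab0 : 0 < b / a by rewrite divr_gt0.
have lnr : b^-1 <= ln (b / a).
  have := expR_ge1Dx (- ln (b / a)); rewrite expRN lnK ?posrE// invf_div => H.
  have E : a / b = 1 - b^-1 by rewrite bE; field; rewrite -bE gt_eqF.
  by rewrite E in H; lra.
have aE : a `^ (- p) = b `^ (- p) * expR (p * ln (b / a)).
  rewrite !powRN /powR !gt_eqF// ln_div ?posrE// mulrBr expRD expRN.
  by field; rewrite !gt_eqF ?expR_gt0.
rewrite aE powRD ?(gt_eqF b0) ?implybT// powRr1 ?(ltW b0)// powRN invfM.
have c0 : 0 < (b `^ p)^-1 by rewrite invr_gt0 powR_gt0.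
rewrite ler_pdivlMl// -[X in _ <= _ - X]mulr1 -mulrBr mulrCA ler_pM2l//.
apply: (@le_trans _ _ (p * ln (b / a))); first by rewrite ler_pM2l.
by have := expR_ge1Dx (p * ln (b / a)); lra.
Qed.

Lemma sum_powR_le (p : R) n : 0 < p ->
  \sum_(0 <= i < n) (i.+1%:R `^ (p + 1))^-1 <= 1 + p^-1 :> R.
Proof.
move=> p0; case: n => [|n].
  by rewrite big_geq// addr_ge0// invr_ge0 ltW.
apply: (@le_trans _ _ (1 + p^-1 * (1 - n.+1%:R `^ (- p)))).
  elim: n => [|n IH].
    by rewrite big_nat1 !powR1 invr1 subrr mulr0 addr0.
  rewrite big_nat_recr//=; apply: le_trans (lerD IH (powR_telescope n p0)) _.
  by rewrite -addrA -mulrDr lerD2l ler_wpM2l ?invr_ge0 ?(ltW p0)//; lra.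
by rewrite lerD2l ler_piMr// ?invr_ge0 ?(ltW p0)//.
Qed.

Lemma sum_geometric_le (t : R) m n : 0 < t < 1 ->
  \sum_(0 <= i < n) t ^+ (m + i) <= t ^+ m / (1 - t).
Proof.
move=> /andP[t0 t1].
rewrite (_ : \sum_(0 <= i < n) _ = t ^+ m * (1 - t ^+ n) / (1 - t)).
  rewrite ler_pM2r ?invr_gt0 ?subr_gt0// ler_piMr ?exprn_ge0 ?(ltW t0)//.
  by rewrite gerBl exprn_ge0 ?(ltW t0).
elim: n => [|n IH]; first by rewrite big_geq// expr0 subrr mulr0 mul0r.
rewrite big_nat_recr//= IH exprD exprS; field.
by rewrite subr_eq0 gt_eqF.
Qed.

Lemma exists_geometric_le (K t e : R) : 0 < t < 1 -> 0 < e ->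
  exists n, K * t ^+ n <= e.
Proof.
move=> /andP[t0 t1] e0.
have : (fun n => K * t ^+ n) @ \oo --> K * 0.
  by apply: cvgMl_tmp; apply: cvg_expr; rewrite ger0_norm// ltW.
rewrite mulr0 => /cvgrPdist_le /(_ _ e0) [n _ /(_ n (leqnn n))] /=.
rewrite sub0r normrN => H; exists n; exact: le_trans (ler_norm _) H.
Qed.

End Series.

(** * Covers by pullbacks of tiles *)

Section Cover.
Context {R : realType}.
Local Notation Re := (@complex.Re R).
Local Notation Im := (@complex.Im R).
Local Notation orb n z := (iter n (@cexp R) z).
Implicit Types (z w : R[i]) (c : nat -> int).

(** The signs and the integer part [n] of the real part locate the image at
    time [N + q + 1] in a tile of bounded size; [sig] alone forces the
    iterates of two members up to time [N + q] into common half-strips. *)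
Definition piece c N q n nu (eps sig : bool) : set R[i] :=
  [set z | [/\ itinerary_set R c z, good z (N + q),
    forall k, (N <= k < N + q)%N -> ~~ good z k, (nu <= good_count z N)%N &
    n%:R <= (-1) ^+ eps * Re (orb (N + q).+1 z) < n.+1%:R /\
    0 < (-1) ^+ sig * Im (orb (N + q).+1 z)]].

(** A common lower bound for the weight at the good time, from the length [q]
    of the stay near the axis and from the position [n] of the tile. *)
Definition gauge (q n : nat) : R :=
  Num.max (expR (q%:R / 16) / 32) (n.+1%:R / 16).

Lemma gauge_gt0 q n : 0 < gauge q n.
Proof. by rewrite lt_max divr_gt0 ?orbT // ltr0n. Qed.

Lemma gauge_ge q n : 32^-1 <= gauge q n.
Proof.
rewrite le_max; apply/orP; right.
have : 1 <= n.+1%:R :> R by rewrite ler1n.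
by lra.
Qed.

Lemma piece_weight c N q n nu eps sig z : piece c N q n nu eps sig z ->
  gauge q n <= weight (orb (N + q) z).
Proof.
move=> [_ gz ngz _ [/andP[nz _] _]]; rewrite ge_max weight_ge_gap//=.
move: gz => /andP[y x]; apply: weight_ge_tile => //.
apply: (le_trans nz); rewrite iterS; apply: le_trans (ler_norm _) _.
by rewrite normrM normrX normrN normr1 expr1n mul1r.
Qed.

Lemma piece_last_dist c N q n nu eps sig z w :
  piece c N q n nu eps sig z -> piece c N q n nu eps sig w ->
  dist2 (orb (N + q).+1 z) (orb (N + q).+1 w) <= 65.
Proof.
move=> [zc _ _ _ [/andP[z1 z2] _]] [wc _ _ _ [/andP[w1 w2] _]].
have p4 := @pihalf_lt2 R.
move: (zc (N + q).+1) (wc (N + q).+1) => /andP[z3 z4] /andP[w3 w4].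
rewrite -natr1 in z2 w2.
rewrite /dist2 (_ : 65 = 1 + 8 ^+ 2); last by ring.
apply: lerD.
  rewrite (_ : _ ^+ 2 = ((-1) ^+ eps * Re (orb (N + q).+1 z) -
      (-1) ^+ eps * Re (orb (N + q).+1 w)) ^+ 2).
    rewrite -real_normK ?num_real// expr_le1// ler_norml.
    by apply/andP; split; lra.
  by rewrite -mulrBr exprMn sqrr_sign mul1r.
rewrite -real_normK ?num_real// lerXn2r ?nnegrE// ler_norml.
by apply/andP; split; lra.
Qed.

(** The tile at time [N + q + 1] has bounded size; one pullback brings the
    hyperbolic distance down to the order of the inverse of the gauge, the
    good times before [N] each contribute a factor, and the last step converts
    to Euclidean distance. *)
Lemma piece_diam : exists g : R, [/\ 0 < g, g < 1 &
  forall c N q n nu eps sig z w, (0 < N)%N ->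
  piece c N q n nu eps sig z -> piece c N q n nu eps sig w ->
  cdist z w <= 33 * g ^+ nu / gauge q n].
Proof.
have C0 : 0 <= 260 * 32 ^+ 2 :> R by rewrite mulr_ge0 ?exprn_ge0.
(* 260 bounds the squared hyperbolic distance times the squared gauge, and
   the gauge is at least 1/32. *)
have [g [g0 g1 gain]] := hyp2_gain C0.
exists (Num.sqrt g); split; first by rewrite sqrtr_gt0.
  by rewrite -sqrtr1 ltr_sqrt.
move=> c N q n nu eps sig z w N0 pz pw.
have W0 := gauge_gt0 q n.
have p4 : (pi : R) ^+ 2 <= 16.
  by rewrite (_ : 16 = 4 ^+ 2) ?lerXn2r ?nnegrE ?pi_ge0//; have := @pihalf_lt2 R; lra.
have [zc _ _ nuz [_ sz]] := pz; have [wc _ _ _ [_ sw]] := pw.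
have sh : forall k, (k <= N + q)%N -> same_half (orb k z) (orb k w).
  move=> k kn; apply: (itinerary_same_half zc wc (n := (N + q).+1)) => //.
  by have := mulr_gt0 sz sw; rewrite mulrACA -expr2 sqrr_sign mul1r.
have hm : hyp2 (orb (N + q) z) (orb (N + q) w) <= 260 / gauge q n ^+ 2.
  have [yy ss yp] := sh _ (leqnn _).
  have H := dist2_cexp_ge yp; rewrite -!iterS in H.
  have D := piece_last_dist pz pw.
  have D2 : dist2 (orb (N + q) z) (orb (N + q) w) *
      expR (Re (orb (N + q) z) + Re (orb (N + q) w)) <= 260.
    have : dist2 (orb (N + q).+1 z) (orb (N + q).+1 w) * pi ^+ 2 <= 65 * 16.
      by apply: ler_pM => //; rewrite ?dist2_ge0 ?sqr_ge0.
    by move: H; lra.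
  have ww : gauge q n ^+ 2 <= weight (orb (N + q) z) * weight (orb (N + q) w).
    by rewrite expr2 ler_pM ?(ltW W0)// ?(piece_weight pz) ?(piece_weight pw).
  rewrite ler_pdivlMr ?exprn_gt0//; apply: le_trans D2.
  apply: (le_trans (ler_wpM2l _ ww)); first by rewrite divr_ge0 ?dist2_ge0 ?ltW.
  rewrite (_ : weight _ * weight _ = Im (orb (N + q) z) * Im (orb (N + q) w) *
      expR (Re (orb (N + q) z) + Re (orb (N + q) w))).
    by rewrite /hyp2 mulrA divfK// gt_eqF.
  by rewrite /weight mulrACA -normrM (gtr0_norm yy) expRD mulrC.
have hC : hyp2 (orb (N + q) z) (orb (N + q) w) <= 260 * 32 ^+ 2.
  have Winv : (gauge q n)^-1 <= 32.
    by rewrite -[leRHS]invrK lef_pV2 ?posrE ?invr_gt0 ?gauge_ge.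
  apply: (le_trans hm); rewrite ler_pM2l// -exprVn lerXn2r ?nnegrE//.
  by rewrite invr_ge0 ltW.
have h1 : hyp2 (cexp z) (cexp w) <= g ^+ nu * (260 / gauge q n ^+ 2).
  case: N N0 nuz sh hm hC {pz pw sz sw} => // N _ nuz sh hm hC.
  have := hyp2_chain g0 gain (n := N + q) (z := z) (w := w).
  move=> /(_ (fun k kn => sh k (leqW kn)) hC) H; apply: (le_trans H).
  apply: ler_pM => //; first by rewrite exprn_ge0// ltW.
    have [yy _ _] := sh _ (leqnn _).
    by rewrite divr_ge0 ?dist2_ge0 ?ltW.
  rewrite ler_wiXn2l ?(ltW g0) ?(ltW g1)//.
  by apply: leq_trans nuz _; apply: good_count_mono; rewrite leq_addr.
apply: cdist_le.
  by rewrite divr_ge0 ?mulr_ge0 ?exprn_ge0 ?sqrtr_ge0 ?ltW.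
have := dist2_le_hyp2 (sh 0%N isT); rewrite /= => H.
rewrite !exprMn exprVn -exprM mulnC exprM sqr_sqrtr ?(ltW g0)//.
have hp : pi ^+ 2 * hyp2 (cexp z) (cexp w) <= 16 * (g ^+ nu * (260 / gauge q n ^+ 2)).
  apply: ler_pM => //; rewrite ?sqr_ge0//.
  have [_ yy _] := sh 0%N isT.
  by rewrite divr_ge0 ?dist2_ge0 ?ltW.
have X0 : 0 <= g ^+ nu / gauge q n ^+ 2.
  by rewrite divr_ge0 ?exprn_ge0 ?ltW.
move: H hp X0; rewrite (_ : 16 * _ = 4160 * (g ^+ nu / gauge q n ^+ 2)); last by ring.
rewrite -(mulrA (33 ^+ 2)); move: (g ^+ nu / gauge q n ^+ 2) => X.
by lra.
Qed.

End Cover.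


Section CoverContent.
Context {R : realType}.
Local Notation Re := (@complex.Re R).
Local Notation Im := (@complex.Im R).
Local Notation orb n z := (iter n (@cexp R) z).
Implicit Types (z w : R[i]) (c : nat -> int).

(** Splitting the exponent as [k + (s - k)], with [k] still above 1, lets the
    first part pay for the sum over tiles and the second for the sum over the
    lengths of stay. *)
Lemma powR_gauge_ge (s k : R) q n : 1 < k -> k < s ->
  (16^-1 `^ k * 32^-1 `^ (s - k)) *
    (n.+1%:R `^ k * (expR (- ((s - k) / 16)) ^+ q)^-1) <= gauge q n `^ s.
Proof.
move=> k1 ks; have W0 := @gauge_gt0 R q n.
have -> : gauge q n `^ s = gauge q n `^ k * gauge q n `^ (s - k).
  by rewrite -powRD ?(gt_eqF W0) ?implybT//; congr powR; ring.
rewrite mulrACA -powRM ?invr_ge0//.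
have -> : (expR (- ((s - k) / 16)) ^+ q)^-1 = expR (q%:R / 16) `^ (s - k).
  by rewrite -expRM_natl -expRN -expRM; congr expR; field.
rewrite -powRM ?expR_ge0 ?invr_ge0//.
apply: ler_pM; rewrite ?powR_ge0//; apply: ge0_ler_powR; rewrite ?nnegrE ?mulr_ge0 ?(ltW W0) ?invr_ge0 ?expR_ge0 ?subr_ge0//; try lra.
  by rewrite le_max mulrC lexx orbT.
by rewrite le_max mulrC lexx.
Qed.

Definition narrow_from c N nu q0 : set R[i] :=
  [set z | [/\ itinerary_set R c z, forall k, Im (orb k z) != 0,
    (nu <= good_count z N)%N & forall k, (N <= k < N + q0)%N -> ~~ good z k]].

Lemma narrow_from_cover c N nu q0 : narrow_from c N nu q0 `<=`
  \bigcup_q \bigcup_n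
   ((piece c N (q0 + q) n nu true true `|` piece c N (q0 + q) n nu true false) `|`
   (piece c N (q0 + q) n nu false true `|` piece c N (q0 + q) n nu false false)).
Proof.
move=> z [zc z0 znu zq].
have : exists k, (N <= k)%N && good z k.
  by have [k Nk gk] := good_infinitely_often z0 N; exists k; rewrite Nk.
move=> /ex_minnP[m /andP[Nm gm] mmin].
have q0m : (N + q0 <= m)%N.
  by rewrite leqNgt; apply/negP => mq; have := zq m; rewrite Nm mq gm => /(_ isT).
have mE : m = (N + (q0 + (m - (N + q0))))%N by rewrite addnA subnKC.
exists (m - (N + q0))%N => //.
exists (Num.truncn `|Re (orb m.+1 z)|) => //.
have P : forall eps sig : bool, (eps = (Re (orb m.+1 z) < 0)) ->
    (sig = (Im (orb m.+1 z) < 0)) ->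
    piece c N (q0 + (m - (N + q0))) (Num.truncn `|Re (orb m.+1 z)|) nu eps sig z.
  move=> eps sig epsE sigE; split => //; rewrite -?mE//.
    move=> k /andP[Nk km]; apply/negP => gk.
    by have := mmin k; rewrite Nk gk leqNgt km => /(_ isT).
  split.
    have -> : (-1) ^+ eps * Re (orb m.+1 z) = `|Re (orb m.+1 z)|.
      rewrite epsE; case: ltrP => r0; first by rewrite ltr0_norm// expr1 mulN1r.
      by rewrite ger0_norm// expr0 mul1r.
    by apply: truncn_itv.
  rewrite sigE; case: (ltrP (Im _) 0) => r0; first by rewrite expr1 mulN1r oppr_gt0.
  by rewrite expr0 mul1r lt_neqAle eq_sym z0.
have := P _ _ erefl erefl.
by case: (_ < 0); case: (_ < 0) => H; [left; left|left; right|right; left|right; right].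
Qed.

(** The central estimate: the sum over tiles is a p-series with exponent above
    1, the sum over lengths of stay a geometric one starting at [q0]. *)
Lemma hausdorff_content_narrow_from (s : R) : 1 < s -> exists K h t : R,
  [/\ 0 < K, 0 < h < 1, 0 < t < 1 & forall c N nu q0, (0 < N)%N ->
    (hausdorff_content (@cdist R) s (narrow_from c N nu q0) <= (K * h ^+ nu * t ^+ q0)%:E)%E].
Proof.
move=> s1; have [g [g0 g1 gdiam]] := @piece_diam R.
pose k : R := (1 + s) / 2.
have k1 : 1 < k by rewrite /k; lra.
have ks : k < s by rewrite /k; lra.
have s0 : 0 < s by lra.
pose h := g `^ s; pose t := expR (- ((s - k) / 16)).
have h01 : 0 < h < 1.
  rewrite powR_gt0//= /h; have := @gt0_ltr_powR R s s0 g 1.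
  by rewrite powR1 !nnegrE (ltW g0) ler01; apply.
have t01 : 0 < t < 1 by rewrite expR_gt0 /= expR_lt1; lra.
pose M := 16^-1 `^ k * 32^-1 `^ (s - k).
have M0 : 0 < M by rewrite mulr_gt0// powR_gt0// invr_gt0.
pose K0 := 33 `^ s / M.
have K00 : 0 < K0 by rewrite divr_gt0// powR_gt0.
pose a n : R := (n.+1%:R `^ ((k - 1) + 1))^-1.
have a0 n : 0 <= a n by rewrite invr_ge0 powR_ge0.
have pb c N q n nu eps sig : (0 < N)%N ->
    (hausdorff_content (@cdist R) s (piece c N q n nu eps sig) <=
     (K0 * h ^+ nu * (t ^+ q * a n))%:E)%E.
  move=> N0; have W0 := @gauge_gt0 R q n.
  apply: (@le_trans _ _ ((33 * g ^+ nu / gauge q n) `^ s)%:E).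
    apply: hausdorff_content_diam_le => //.
      by rewrite divr_ge0 ?mulr_ge0 ?exprn_ge0 ?ltW.
    by move=> z w pz pw; exact: gdiam pz pw.
  rewrite lee_fin !powRM ?mulr_ge0 ?exprn_ge0 ?invr_ge0 ?(ltW g0) ?(ltW W0)//.
  rewrite -[g ^+ nu]powR_mulrn ?(ltW g0)// powRAC powR_mulrn ?powR_ge0// -/h.
  rewrite -[(gauge q n)^-1]powR_inv1 ?(ltW W0)// powRAC powR_inv1 ?powR_ge0//.
  rewrite /K0 -!mulrA ler_pM2l ?powR_gt0// [leRHS]mulrCA ler_pM2l ?exprn_gt0 ?(andP h01).1//.
  have H := powR_gauge_ge q n k1 ks; rewrite -/M -/t in H.
  have tq : 0 < t ^+ q by rewrite exprn_gt0 ?(andP t01).1.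
  rewrite /a subrK -[leRHS]invrK lef_pV2 ?posrE ?powR_gt0//.
    by apply: le_trans H; rewrite !invfM !invrK [X in _ <= _ * X]mulrC.
  by rewrite invr_gt0 !mulr_gt0 ?invr_gt0 ?powR_gt0.
pose K := 4 * K0 * (1 + (k - 1)^-1) / (1 - t).
have [/andP[h0 h1] /andP[t0 t1]] := (h01, t01).
have kk : 0 < 1 + (k - 1)^-1 by rewrite addr_gt0// invr_gt0; lra.
exists K, h, t; split.
- have t1' : 0 < 1 - t by rewrite subr_gt0.
  by apply: divr_gt0 => //; apply: mulr_gt0 kk; apply: mulr_gt0.
- exact: h01.
- exact: t01.
move=> c N nu q0 N0.
apply: le_trans (hausdorff_content_mono _ _ (@narrow_from_cover c N nu q0)) _.
have A0 : 0 <= 4 * K0 * h ^+ nu.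
  by apply: mulr_ge0; rewrite ?exprn_ge0 ?(ltW h0)// mulr_ge0// ltW.
pose E q := 4 * K0 * h ^+ nu * (1 + (k - 1)^-1) * t ^+ (q0 + q).
apply: (@hausdorff_content_bigcup_le _ _ _ _ _ E).
  move=> q; apply: (@hausdorff_content_bigcup_le _ _ _ _ _
    (fun n => 4 * K0 * h ^+ nu * t ^+ (q0 + q) * a n)).
    move=> n; pose x := K0 * h ^+ nu * (t ^+ (q0 + q) * a n).
    rewrite (_ : 4 * _ * _ * _ * _ = (x + x) + (x + x)); last by rewrite /x; ring.
    by do !apply: hausdorff_content_setU_le => //; exact: pb.
  move=> n; rewrite -mulr_sumr /E [leRHS]mulrAC; apply: ler_wpM2l.
    by rewrite mulr_ge0// exprn_ge0// ltW.
  by apply: sum_powR_le; lra.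
move=> n; rewrite -mulr_sumr.
rewrite (_ : K * h ^+ nu * t ^+ q0 =
  4 * K0 * h ^+ nu * (1 + (k - 1)^-1) * (t ^+ q0 / (1 - t))); last by rewrite /K; ring.
by apply: ler_wpM2l; rewrite ?sum_geometric_le// mulr_ge0// ltW.
Qed.

End CoverContent.


(** * Null sets of points with a given itinerary *)

Section LipschitzPullback.
Context {R : realType} {T T' : Type}.
Variables (d : T -> T -> R) (d' : T' -> T' -> R) (s : R).
Hypothesis s_gt0 : 0 < s.

Lemma hausdorff_content_lipschitz_pullback0 (f : T -> T') (A : set T) (B : set T') (L : R) :
  0 < L -> (forall x, A x -> B (f x)) ->
  (forall x y, A x -> A y -> d x y <= L * d' (f x) (f y)) ->
  hausdorff_content d' s B = 0%E -> hausdorff_content d s A = 0%E.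
Proof.
move=> L0 AB dL B0; apply: hausdorff_content_eq0 => // e e0.
have Ls : 0 < L `^ s by exact: powR_gt0.
have : (hausdorff_content d' s B < (e / L `^ s)%:E)%E by rewrite B0 lte_fin divr_gt0.
move=> /ereal_inf_lt[_ [U BU <-] /ltW Ue].
apply: (@le_trans _ _ (\sum_(k <oo) diam d (A `&` f @^-1` U k) `^ s)%E).
  apply: ereal_inf_lbound; exists (fun k => A `&` f @^-1` U k) => // x Ax.
  by have [k _ Uk] := BU _ (AB _ Ax); exists k.
apply: (@le_trans _ _ (\sum_(k <oo) ((L `^ s)%:E * diam d' (U k) `^ s))%E).
  apply: lee_nneseries => k *; first exact: poweR_ge0.
  rewrite -poweR_EFin -poweRM ?lee_fin ?diam_ge0 ?(ltW L0)//.
  apply: poweR_le2 => //; first exact: diam_ge0.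
  apply: ge_ereal_sup => _ [->|[[x y] [/= [Ax Ux] [Ay Uy]] <-]].
    by rewrite mule_ge0 ?lee_fin ?diam_ge0 ?ltW.
  apply: (@le_trans _ _ (L%:E * (d' (f x) (f y))%:E)%E).
    by rewrite -EFinM lee_fin dL.
  by rewrite lee_pmul2l ?lte_fin// le_diam.
rewrite nneseriesZl; last by move=> k _; exact: poweR_ge0.
apply: (le_trans (lee_wpmul2l _ Ue)); first by rewrite lee_fin ltW.
by rewrite -EFinM lee_fin mulrC divfK// gt_eqF.
Qed.

End LipschitzPullback.

Section NullSets.
Context {R : realType}.
Local Notation Re := (@complex.Re R).
Local Notation Im := (@complex.Im R).
Local Notation orb n z := (iter n (@cexp R) z).
Implicit Types (z w : R[i]) (c : nat -> int).
Variable s : R.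
Hypothesis s_gt1 : 1 < s.

Let s_gt0 : 0 < s. Proof. exact: lt_trans s_gt1. Qed.

(** On a half-strip with real parts bounded below, the inverse of the
    exponential is Lipschitz, and the plane is a countable union of such sets. *)
Lemma hausdorff_content_preimage_cexp0 (B : set R[i]) :
  hausdorff_content (@cdist R) s B = 0%E -> hausdorff_content (@cdist R) s (@cexp R @^-1` B) = 0%E.
Proof.
move=> B0; have p0 := @pi_gt0 R.
pose A (K n : nat) (eps : bool) := [set z | [/\ B (cexp z), - K%:R <= Re z &
  n%:R * pi <= (-1) ^+ eps * Im z < n.+1%:R * pi]].
have A0 K n eps : hausdorff_content (@cdist R) s (A K n eps) = 0%E.
  apply: (@hausdorff_content_lipschitz_pullback0 _ _ _ _ (@cdist R) _ s_gt0 (@cexp R) _ B (2 * expR K%:R)) => //.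
    by move=> z [].
  move=> z w [_ zK /andP[z1 z2]] [_ wK /andP[w1 w2]].
  have yp : `|Im z - Im w| <= pi.
    have -> : `|Im z - Im w| = `|(-1) ^+ eps * Im z - (-1) ^+ eps * Im w|.
      by rewrite -mulrBr normrM normrX normrN normr1 expr1n mul1r.
    rewrite -natr1 mulrDl mul1r in z2 w2.
    by rewrite ler_norml; apply/andP; split; lra.
  have H := dist2_cexp_ge yp.
  have p4 : (pi : R) ^+ 2 <= 16.
    by rewrite (_ : 16 = 4 ^+ 2) ?lerXn2r ?nnegrE ?pi_ge0//; have := @pihalf_lt2 R; lra.
  apply: cdist_le; first by rewrite !mulr_ge0 ?expR_ge0// cdistE sqrtr_ge0.
  rewrite cdistE !exprMn sqr_sqrtr ?dist2_ge0//.
  have e1 : 1 <= expR (Re z + Re w) * expR K%:R ^+ 2.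
    by rewrite -expRM_natl -expRD -[leLHS](@expR0 R) ler_expR; lra.
  have D0 := dist2_ge0 z w; have D1 := dist2_ge0 (cexp z) (cexp w).
  have X : dist2 (cexp z) (cexp w) * pi ^+ 2 <= dist2 (cexp z) (cexp w) * 16.
    by rewrite ler_wpM2l.
  apply: (@le_trans _ _ (expR K%:R ^+ 2 * (expR (Re z + Re w) * dist2 z w))).
    by rewrite mulrA ler_peMl// mulrC.
  rewrite [leRHS]mulrAC mulrC ler_wpM2r ?sqr_ge0//.
  by move: H; rewrite -mulrA; move: (_ * dist2 z w) X => v; lra.
apply: (@hausdorff_content_sub0 _ _ _ _ _ (\bigcup_K \bigcup_n (A K n true `|` A K n false))).
  move=> z /= Bz.
  exists (Num.truncn `|Re z|).+1 => //; exists (Num.truncn (`|Im z| / pi)) => //.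
  have zK : - (Num.truncn `|Re z|).+1%:R <= Re z.
    rewrite lerNl; apply: le_trans (ler_norm _) _; rewrite normrN ltW//.
    exact: truncnS_gt.
  have /andP[t1 t2] : (Num.truncn (`|Im z| / pi))%:R <= `|Im z| / pi < (Num.truncn (`|Im z| / pi)).+1%:R.
    by apply: truncn_itv; rewrite divr_ge0// ltW.
  rewrite ler_pdivlMr// in t1; rewrite ltr_pdivrMr// in t2.
  have [y0|y0] := ltP (Im z) 0; [left|right]; split => //.
    by rewrite expr1 mulN1r -(ltr0_norm y0) t1.
  by move: t1 t2; rewrite expr0 mul1r (ger0_norm y0) => -> ->.
by do 2!(apply: hausdorff_content_bigcup0 => ?); apply: hausdorff_content_setU0.
Qed.

Lemma hausdorff_content_eventually_real0 n :
  hausdorff_content (@cdist R) s [set z | Im (orb n z) = 0] = 0%E.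
Proof.
elim: n => [|n IH]; last first.
  apply: hausdorff_content_sub0 (hausdorff_content_preimage_cexp0 IH) => z.
  by rewrite /preimage /mkset iterSr.
pose A (n : nat) (eps : bool) := [set z | Im z = 0 /\ n%:R <= (-1) ^+ eps * Re z < n%:R + 1].
have A0 n eps : hausdorff_content (@cdist R) s (A n eps) = 0%E.
  apply: (@hausdorff_content_unit_segment _ _ _ _ s_gt1 _ (fun z => (-1) ^+ eps * Re z) n%:R).
    by move=> z [].
  move=> z w [z0 _] [w0 _]; apply: cdist_le => //.
  rewrite real_normK ?num_real// -mulrBr exprMn sqrr_sign mul1r /dist2 z0 w0.
  by rewrite subrr expr0n addr0.
apply: (@hausdorff_content_sub0 _ _ _ _ _ (\bigcup_n (A n true `|` A n false))).
  move=> z /= z0; exists (Num.truncn `|Re z|) => //.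
  have /andP[t1 t2] : (Num.truncn `|Re z|)%:R <= `|Re z| < (Num.truncn `|Re z|).+1%:R.
    exact: truncn_itv.
  rewrite -natr1 in t2.
  have [x0|x0] := ltP (Re z) 0; [left|right]; split => //.
    by rewrite expr1 mulN1r -(ltr0_norm x0) t1.
  by move: t1 t2; rewrite expr0 mul1r (ger0_norm x0) => -> ->.
by apply: hausdorff_content_bigcup0 => ?; apply: hausdorff_content_setU0.
Qed.

Definition frequently_good c N0 : set R[i] :=
  [set z | [/\ itinerary_set R c z, forall k, Im (orb k z) != 0 &
    forall N, (N0 < N)%N -> exists2 k, (N <= k < N + N)%N & good z k]].

(** Doubling [N] produces a new good time, and the starting value [N0 + 1] is
    doubled [nu] times. *)
Lemma good_count_frequently c N0 z nu : frequently_good c N0 z ->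
  (nu <= good_count z (2 ^ nu * N0.+1))%N.
Proof.
move=> [_ _ H]; elim: nu => // nu IH.
have [|k /andP[k1 k2] gk] := H (2 ^ nu * N0.+1)%N.
  by rewrite leq_pmull ?expn_gt0.
have kN : (k.+1 <= 2 ^ nu.+1 * N0.+1)%N by rewrite expnS -mulnA mul2n -addnn.
apply: leq_trans (good_count_mono z kN).
have := leq_trans IH (good_count_mono z k1).
case: k k1 k2 gk kN => [|k] k1 k2 gk kN; last by rewrite good_countS gk addn1.
by move: k1; rewrite leqn0 muln_eq0 expn_eq0.
Qed.

(** The number of good times before [2^nu (N0 + 1)] is at least [nu] for all
    points at once, so one application of the estimate for each [nu] gives
    bounds tending to 0. *)
Lemma hausdorff_content_frequently_good0 c N0 :
  hausdorff_content (@cdist R) s (frequently_good c N0) = 0%E.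
Proof.
have [K [h [t [K0 h01 t01 H]]]] := hausdorff_content_narrow_from s_gt1.
apply: hausdorff_content_eq0 => // e e0.
have [nu Knu] := exists_geometric_le K h01 e0.
apply: (@le_trans _ _ (hausdorff_content (@cdist R) s (narrow_from c (2 ^ nu * N0.+1) nu 0))).
  apply: hausdorff_content_mono => z zf; have [zc z0 _] := zf; split => //.
    exact: good_count_frequently zf.
  by move=> k; rewrite addn0 ltnNge andbN.
apply: le_trans (H _ _ _ _ _) _; first by rewrite muln_gt0 expn_gt0.
by rewrite expr0 mulr1 lee_fin.
Qed.

Definition infinitely_often_narrow c : set R[i] :=
  [set z | [/\ itinerary_set R c z, forall k, Im (orb k z) != 0 &
    forall N0, exists2 N, (N0 <= N)%N &
      forall k, (N <= k < N + N)%N -> ~~ good z k]].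

(** Borel-Cantelli: the contents for the individual [N] are at most a multiple
    of [t^N], and tails of a geometric series tend to 0. *)
Lemma hausdorff_content_infinitely_often_narrow0 c :
  hausdorff_content (@cdist R) s (infinitely_often_narrow c) = 0%E.
Proof.
have [K [h [t [K0 h01 t01 H]]]] := hausdorff_content_narrow_from s_gt1.
have [/andP[t0 t1]] := t01.
apply: hausdorff_content_eq0 => // e e0.
have [n Kn] := exists_geometric_le (K / (1 - t)) t01 e0.
apply: (@le_trans _ _ (hausdorff_content (@cdist R) s
    (\bigcup_i narrow_from c (n.+1 + i) 0 (n.+1 + i)))).
  apply: hausdorff_content_mono => z [zc z0 zN]; have [N nN gN] := zN n.+1.
  by exists (N - n.+1)%N => //; rewrite subnKC.
apply: (@hausdorff_content_bigcup_le _ _ _ _ _ (fun i => K * t ^+ (n.+1 + i))).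
  by move=> i; apply: le_trans (H _ _ _ _ _) _; rewrite // expr0 mulr1.
move=> m; rewrite -mulr_sumr; apply: le_trans Kn.
rewrite mulrAC -mulrA ler_pM2l//; apply: le_trans (sum_geometric_le _ _ t01) _.
rewrite ler_pM2r ?invr_gt0 ?subr_gt0//.
by rewrite exprS ler_piMl ?exprn_ge0 ?ltW.
Qed.

Lemma hausdorff_content_itinerary0 c : hausdorff_content (@cdist R) s (itinerary_set R c) = 0%E.
Proof.
apply: (@hausdorff_content_sub0 _ _ _ _ _ ((\bigcup_n [set z | Im (orb n z) = 0]) `|`
  ((\bigcup_N frequently_good c N) `|` infinitely_often_narrow c))).
  move=> z zc.
  have [[n zn]|/forallNP zr] := pselect (exists n, Im (orb n z) = 0).
    by left; exists n.
  have z0 k : Im (orb k z) != 0 by apply/eqP; exact: zr.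
  right; have [[N HN]|/forallNP HN] := pselect (exists N0, forall N, (N0 < N)%N ->
      exists2 k, (N <= k < N + N)%N & good z k).
    by left; exists N.
  right; split => // N0.
  have /existsNP[N /not_implyP[N0N /forall2NP nk]] := HN N0.
  exists N; first exact: ltnW.
  by move=> k kN; have [|/negP] := nk k.
apply: hausdorff_content_setU0 => //.
  by apply: hausdorff_content_bigcup0 => n; exact: hausdorff_content_eventually_real0.
apply: hausdorff_content_setU0 => //; last exact: hausdorff_content_infinitely_often_narrow0.
by apply: hausdorff_content_bigcup0 => n; exact: hausdorff_content_frequently_good0.
Qed.

End NullSets.


(** * Growth of itineraries and existence of hairs *)

Section Crossing.
Context {R : realType}.

(** The first point where [h] takes the value [q] is the minimum of a compact
    set, and [h] stays below [q] before it by the intermediate value theorem. *)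
Lemma first_hit (h : R -> R) (a b q : R) : continuous h -> a <= b ->
  h a <= q -> q <= h b ->
  exists c, [/\ a <= c, c <= b, h c = q & forall t, a <= t <= c -> h t <= q].
Proof.
move=> ch ab haq qhb.
pose S := `[a, b]%classic `&` h @^-1` [set q].
have S0 : S !=set0.
  have [|c cab hc] := @IVT R h a b q ab (continuous_subspaceT ch).
    by rewrite ge_min haq le_max qhb orbT.
  by exists c.
have Sc : compact S.
  apply: compact_closedI; first exact: segment_compact.
  by apply: preimage_closed => [x _|]; [exact: ch | exact: closed_eq].
have [c] := @compact_EVT_min _ R (fun x => x) S S0 Sc (continuous_subspaceT (fun x => cvg_id)).
rewrite inE => -[/=]; rewrite in_itv /= => /andP[ac cb] hc cmin.
exists c; split => // t /andP[at_ tc].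
rewrite leNgt; apply/negP => qt.
have [|u] := @IVT R h a t q at_ (continuous_subspaceT ch).
  by rewrite ge_min haq le_max (ltW qt) orbT.
rewrite in_itv /= => /andP[au ut] hu.
have cu : c <= u.
  by apply: cmin; rewrite inE; split => //=; rewrite in_itv /= au (le_trans ut (le_trans tc cb)).
have E : t = u by apply/eqP; rewrite eq_le ut andbT (le_trans tc).
by rewrite E hu ltxx in qt.
Qed.

Lemma last_hit (h : R -> R) (a b p : R) : continuous h -> a <= b ->
  h a <= p -> p <= h b ->
  exists c, [/\ a <= c, c <= b, h c = p & forall t, c <= t <= b -> p <= h t].
Proof.
move=> ch ab hap phb.
have [||||c []] := @first_hit (fun t => - h (- t)) (- b) (- a) (- p);
  rewrite /= ?opprK ?lerN2 //.
  move=> x; apply: continuousN.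
  by apply: (@continuous_comp _ _ _ (fun x => - x) h); [exact: opp_continuous | exact: ch].
move=> bc ca hc H; exists (- c); split; rewrite 1?lerNl 1?lerNr ?opprK//.
  by rewrite -[LHS]opprK hc opprK.
move=> t /andP[ct tb]; rewrite -lerN2 -{1}[t]opprK; apply: H.
by rewrite lerN2 tb lerNl.
Qed.

Lemma crossing (h : R -> R) (a b p q : R) : continuous h -> a <= b ->
  p <= q -> h a <= p -> q <= h b ->
  exists a' b', [/\ a <= a', a' <= b', b' <= b, h a' = p & h b' = q] /\
    forall t, a' <= t <= b' -> p <= h t <= q.
Proof.
move=> ch ab pq hap qhb.
have [b' [ab' bb' hb' Hb]] := first_hit ch ab (le_trans hap pq) qhb.
have pb' : p <= h b' by rewrite hb'.
have [a' [aa' a'b' ha' Ha]] := last_hit ch ab' hap pb'.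
exists a', b'; split => // t /andP[a't tb'].
by rewrite Ha ?a't// Hb// tb' (le_trans aa').
Qed.

End Crossing.

Section Hair.
Context {R : realType}.
Local Notation Re := (@complex.Re R).
Local Notation Im := (@complex.Im R).
Local Notation orb n z := (iter n (@cexp R) z).
Local Notation F k x := (iter k (fun t : R => expR t - 1) x).
Implicit Types (z w : R[i]) (c : nat -> int).

(** The margin 2 reproduces itself: [expR T - 1 >= expR (T - 2) + 2] as soon
    as [T >= 2]. *)
Lemma exponentially_bounded_of_nonempty c :
  itinerary_set R c !=set0 -> exponentially_bounded R c.
Proof.
move=> [z zc]; have p2 := @pi_ge2 R.
pose x := `|Re z| + `|Im z| + 2.
have H k : Re (orb k z) + 2 <= F k x /\ `|Im (orb k z)| + 2 <= F k x.
  elim: k => [|k [IH1 IH2]].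
    have := ler_norm (Re z); have := normr_ge0 (Re z); have := normr_ge0 (Im z).
    by rewrite /x /=; split; lra.
  have T2 : 2 <= F k x by apply: le_trans IH2; rewrite lerDr.
  have E : expR (Re (orb k z)) + 2 <= F k.+1 x.
    rewrite iterS; move: (F k x) IH1 T2 => T IH1 T2.
    have e1 : expR (Re (orb k z)) <= expR (T - 2) by rewrite ler_expR; lra.
    have e2 : 1 <= expR (T - 2) by have := expR_ge1Dx (T - 2); lra.
    have e3 : 4 * expR (T - 2) <= expR T.
      have -> : expR T = expR 1 * expR 1 * expR (T - 2).
        by rewrite -!expRD; congr expR; ring.
      rewrite ler_pM2r ?expR_gt0//; have := expR_ge1Dx (1 : R).
      by move: (expR 1) => e; nra.
    by lra.
  have e0 := expR_ge0 (Re (orb k z)).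
  rewrite [in orb k.+1 z]iterS Re_cexp Im_cexp normrM (ger0_norm e0).
  by split; apply: le_trans E; rewrite lerD2r ler_piMr// ?sin_max.
exists 1, x; split => //.
  by rewrite /x ltr_wpDl// addr_ge0.
move=> k; rewrite mul1r; apply: lt_le_trans (H k).2.
have /andP[k1 k2] := zc k; rewrite intr_norm.
have : `|2 * pi * (c k)%:~R - Im (orb k z)| <= pi.
  by rewrite ler_norml; apply/andP; split; lra.
move=> d; have : 2 * pi * `|(c k)%:~R| <= `|Im (orb k z)| + pi.
  rewrite -[2 * pi]ger0_norm; last by lra.
  rewrite -normrM; apply: le_trans (lerD (lexx `|Im (orb k z)|) d).
  by rewrite -{1}[2 * pi * (c k)%:~R](subrK (Im (orb k z))) addrC ler_normD.
have := normr_ge0 ((c k)%:~R : R); have := normr_ge0 (Im (orb k z)).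
move: (`|_|) (`|_|) => u v u0 v0 h.
by nra.
Qed.

Lemma continuous_orbit (xi : R) n :
  continuous (fun y => Re (orb n (Complex xi y))) /\
  continuous (fun y => Im (orb n (Complex xi y))).
Proof.
elim: n => [|n [IH1 IH2]].
  by split => y /=; [exact: cst_continuous | exact: cvg_id].
have cE : continuous (fun y => expR (Re (orb n (Complex xi y)))).
  by move=> y; apply: continuous_comp; [exact: IH1 | exact: continuous_expR].
split => y.
  have -> : (fun y => Re (orb n.+1 (Complex xi y))) =
     (fun y => expR (Re (orb n (Complex xi y))) * cos (Im (orb n (Complex xi y)))).
    by apply/funext => t; rewrite iterS Re_cexp.
  apply: cvgM; first exact: cE.
  by apply: continuous_comp; [exact: IH2 | exact: continuous_cos].
have -> : (fun y => Im (orb n.+1 (Complex xi y))) =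
   (fun y => expR (Re (orb n (Complex xi y))) * sin (Im (orb n (Complex xi y)))).
  by apply/funext => t; rewrite iterS Im_cexp.
apply: cvgM; first exact: cE.
by apply: continuous_comp; [exact: IH2 | exact: continuous_sin].
Qed.

End Hair.


Section HairConstruction.
Context {R : realType}.
Local Notation Re := (@complex.Re R).
Local Notation Im := (@complex.Im R).
Local Notation orb n z := (iter n (@cexp R) z).
Local Notation F k x := (iter k (fun t : R => expR t - 1) x).
Implicit Types (z w : R[i]).

Variables (c : nat -> int) (m : nat -> R).
Hypothesis m_ge0 : forall n, 0 <= m n.
Hypothesis m_step : forall n,
  m n.+1 + (2 * pi * `|(c n.+1)%:~R| + 2) <= expR (m n).

(** The end heights make the arguments of the next iterate [- pi / 2] and [pi
    / 2], so that the next image starts and ends on the imaginary axis. *)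
Definition crosses (xi : R) n (ab : R * R) :=
  [/\ ab.1 <= ab.2,
    Im (orb n (Complex xi ab.1)) = 2 * pi * (c n)%:~R - pi / 2,
    Im (orb n (Complex xi ab.2)) = 2 * pi * (c n)%:~R + pi / 2 &
    forall y, ab.1 <= y <= ab.2 ->
      m n <= Re (orb n (Complex xi y)) /\
      `|Im (orb n (Complex xi y)) - 2 * pi * (c n)%:~R| <= pi / 2].

Lemma sin_shift_int (k : int) (y : R) : sin (2 * pi * k%:~R + y) = sin y.
Proof. by rewrite -[LHS](sin_sub_int k); congr sin; ring. Qed.

Lemma cos_shift_int (k : int) (y : R) : cos (2 * pi * k%:~R + y) = cos y.
Proof.
by rewrite -!sinDpihalf -addrA sin_shift_int.
Qed.

(** The image of a crossing stays outside the disc of radius [expR (m n)] and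
    goes from the lower to the upper imaginary axis, so its imaginary part
    sweeps a range that contains the middle of the next strip. Where it does
    so the imaginary part is small against the radius, so the real part is
    large. *)
Lemma crosses_step xi n ab : crosses xi n ab ->
  exists ab', [/\ crosses xi n.+1 ab', ab.1 <= ab'.1 & ab'.2 <= ab.2].
Proof.
case: ab => a b [/= ab Ia Ib H]; have p0 := @pi_gt0 R.
have p4 := @pihalf_lt2 R.
have [_ ch] := continuous_orbit xi n.+1.
have c0 := normr_ge0 ((c n.+1)%:~R : R).
set C : R := 2 * pi * (c n.+1)%:~R.
have CE : 2 * pi * `|(c n.+1)%:~R| = `|C|.
  by rewrite /C normrM ger0_norm// mulr_ge0// ltW.
have ms := m_step n; rewrite CE in ms.
have C1 := ler_norm C; have C2 := ler_norm (- C); rewrite normrN in C2.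
have mS := m_ge0 n.+1.
have aab : a <= a <= b by rewrite lexx.
have bab : a <= b <= b by rewrite lexx andbT.
have ea : expR (m n) <= expR (Re (orb n (Complex xi a))) by rewrite ler_expR (H _ aab).1.
have eb : expR (m n) <= expR (Re (orb n (Complex xi b))) by rewrite ler_expR (H _ bab).1.
have ha : Im (orb n.+1 (Complex xi a)) <= C - pi / 2.
  rewrite iterS Im_cexp Ia sin_shift_int sinN sin_pihalf mulrN1; lra.
have hb : C + pi / 2 <= Im (orb n.+1 (Complex xi b)).
  rewrite iterS Im_cexp Ib sin_shift_int sin_pihalf mulr1; lra.
have [|a' [b' [[aa' ab' bb' ha' hb'] K]]] := crossing ch ab _ ha hb; first by lra.
exists (a', b'); split => //; split => // y /andP[ay yb].
have /K /andP[y1 y2] : a' <= y <= b' by rewrite ay.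
have yn : `|Im (orb n.+1 (Complex xi y)) - C| <= pi / 2.
  by rewrite ler_norml; apply/andP; split; lra.
split => //.
have /H[x1 x2] : a <= y <= b by rewrite (le_trans aa' ay) (le_trans yb bb').
have re0 : 0 <= Re (orb n.+1 (Complex xi y)).
  rewrite iterS Re_cexp mulr_ge0 ?expR_ge0//.
  rewrite -[X in cos X](subrK (2 * pi * (c n)%:~R)) addrC cos_shift_int.
  by rewrite cos_ge0_pihalf// -ler_norml.
have N := norm2_cexp (orb n (Complex xi y)); rewrite -iterS in N.
have er : expR (m n) <= expR (Re (orb n (Complex xi y))) by rewrite ler_expR.
have i0 := normr_ge0 (Im (orb n.+1 (Complex xi y))).
have i1 : `|Im (orb n.+1 (Complex xi y))| <= `|C| + 2.
  by rewrite ler_norml; apply/andP; split; lra.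
move: N; rewrite -[Im _ ^+ 2]real_normK ?num_real//.
move: (`|Im (orb n.+1 _)|) (Re (orb n.+1 _)) (expR (Re _)) i0 i1 re0 er => u v e u0 u1 v0 me N.
have muE : m n.+1 + u <= e by lra.
have : (m n.+1 + u) ^+ 2 <= v ^+ 2 + u ^+ 2.
  by rewrite N lerXn2r ?nnegrE ?addr_ge0//; apply: le_trans muE; rewrite addr_ge0.
rewrite sqrrD => S; rewrite -ler_sqr ?nnegrE//.
by have := mulr_ge0 mS u0; lra.
Qed.

Lemma hair_point xi : m 0%N <= xi -> exists2 z, itinerary_set R c z & Re z = xi.
Proof.
move=> mxi; have p0 := @pi_gt0 R.
have /choice[next Hnext] : forall p : nat * (R * R), exists q : R * R,
    crosses xi p.1 p.2 -> [/\ crosses xi p.1.+1 q, p.2.1 <= q.1 & q.2 <= p.2.2].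
  move=> [n ab] /=; have [/crosses_step[q Hq]|nc] := pselect (crosses xi n ab).
    by exists q.
  by exists ab.
pose I := fix I n := if n is n'.+1 then next (n', I n') else
  (2 * pi * (c 0%N)%:~R - pi / 2, 2 * pi * (c 0%N)%:~R + pi / 2).
have HI n : crosses xi n (I n).
  elim: n => [|n IH]; last by have [] := Hnext (n, I n) IH.
  split => //=; first by lra.
  by move=> y /andP[y1 y2]; split => //; rewrite ler_norml; apply/andP; split; lra.
have mono n k : (I n).1 <= (I (n + k)%N).1 /\ (I (n + k)%N).2 <= (I n).2.
  elim: k => [|k [IH1 IH2]]; first by rewrite addn0.
  have [_ h1 h2] := Hnext (_, I _) (HI (n + k)%N).
  by rewrite addnS; split; [exact: le_trans h1 | exact: le_trans IH2].
have le12 n k : (I n).1 <= (I k).2.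
  have [ab _ _ _] := HI (n + k)%N.
  apply: (le_trans (mono n k).1); apply: (le_trans ab).
  by rewrite addnC; exact: (mono k n).2.
pose y := sup (range (fun n => (I n).1)).
have sI : has_sup (range (fun n => (I n).1)).
  by split; [exists (I 0%N).1; exists 0%N | exists (I 0%N).2 => _ [n _ <-]].
have yI n : (I n).1 <= y <= (I n).2.
  apply/andP; split; first by apply: ub_le_sup; [exact: sI.2 | exists n].
  by apply: ge_sup; [exact: sI.1 | move=> _ [k _ <-]].
exists (Complex xi y) => // n.
(* The crossings stay at distance at least [pi / 2] from the sides of the
   strips, so it does not matter which side is closed. *)
have [_ _ _ /(_ _ (yI n))[_]] := HI n.
by rewrite ler_norml => /andP[y1 y2]; apply/andP; split; lra.
Qed.

End HairConstruction.

Section Main.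
Context {R : realType}.
Local Notation F k x := (iter k (fun t : R => expR t - 1) x).

(** Take [m k = M + F^k x]. The functional equation of [F] turns [expR (m k)]
    into [expR M] times [F^(k+1) x + 1], and a large [M] leaves room for
    [c_(k+1)]. *)
Lemma itinerary_set_Re_onto (c : nat -> int) : exponentially_bounded R c ->
  exists a : R, forall t, a <= t -> exists2 z, itinerary_set R c z & complex.Re z = t.
Proof.
move=> [A [x [A0 x0 cA]]]; have p0 := @pi_gt0 R; have p4 := @pihalf_lt2 R.
pose M := 8 * A + 2.
have F0 k : 0 <= F k x.
  elim: k => [|k IH]; first exact: ltW.
  by rewrite iterS; have := expR_ge1Dx (F k x); lra.
exists (M + F 0%N x) => t Mt.
apply: (@hair_point _ c (fun k => M + F k x)) => // k.
  by rewrite addr_ge0// /M; lra.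
have := cA k.+1; rewrite intr_norm.
have := F0 k.+1; have := normr_ge0 ((c k.+1)%:~R : R).
have -> : expR (M + F k x) = expR M * (F k.+1 x + 1) by rewrite expRD iterS subrK.
move: (F k.+1 x) (`|_|) => u v v0 u0 vA.
have eM : M + 2 <= expR M.
  have -> : expR M = expR (M / 2) * expR (M / 2) by rewrite -expRD; congr expR; field.
  have := expR_ge1Dx (M / 2); move: (expR _) => e; rewrite /M => e1.
  by nra.
have e8 : 8 * A + 1 <= expR M by apply: le_trans eM; rewrite /M; lra.
have u1 : (8 * A + 1) * u <= expR M * u by rewrite ler_wpM2r.
have v8 : 2 * pi * v <= 8 * v by rewrite ler_wpM2r//; lra.
have -> : expR M * (u + 1) = expR M * u + expR M by ring.
by lra.
Qed.

End Main.

Theorem corollary2 (R : realType) (c : nat -> int) :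
  (itinerary_set R c !=set0 <-> exponentially_bounded R c) /\
  (itinerary_set R c !=set0 ->
   hausdorff_dim (@cdist R) (itinerary_set R c) = 1%E).
Proof.
split.
  split; first exact: exponentially_bounded_of_nonempty.
  by move=> /itinerary_set_Re_onto[a /(_ a (lexx a))[z zc _]]; exists z.
move=> /exponentially_bounded_of_nonempty /itinerary_set_Re_onto[a onto].
apply/eqP; rewrite eq_le; apply/andP; split.
  by apply: hausdorff_dim_le1 => s s1; exact: hausdorff_content_itinerary0.
apply: (@hausdorff_dim_ge1 _ _ _ _ (@complex.Re R) a); first exact: Re_lipschitz.
by move=> t /andP[at_ _]; exact: onto.
Qed.
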